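(* Let $q$ be a prime power, $n\ge 1$ an integer, and $r\in\mathbb{Z}_{\ge0}$. Then: (a) The $G$-module $\mathcal{IR}_q^r$ has a basis given by $$\{v_K\mid K\in\mathcal{P}_{n\times r}(q)\},$$ and thus $\dim(\mathcal{IR}_q^r)=d_{n,r}(q)$. (b) The $L$-module $\mathcal{IR}_q^{r+\frac12}$ (identified with the subspace $1\otimes_{\mathbb{C}P}e_U\mathcal{IR}_q^r$ of $\mathcal{IR}_q^{r+1}$) has a basis given by $$\{v_K\mid K=((k_1,a^{(1)}),\ldots,(k_{r+1},a^{(r+1)}))\in\mathcal{P}_{n\times (r+1)}(q)\text{ with }k_1=0\},$$ and thus $\dim(\mathcal{IR}_q^{r+\frac12})=d_{n,r+1}(q)/[n]$.
   Context: All modules are over $\mathbb{C}$. $G=\mathrm{GL}_n(\mathbb{F}_q)$. $L\subseteq G$ is the subgroup of block-diagonal matrices with blocks of sizes $1$ and $n-1$ (in this order). $U\subseteq G$ is the subgroup of matrices with ones on the diagonal whose only other possibly nonzero entries are in positions $(1,j)$, $2\le j\le n$. $P=LU$, and $e_U=\frac1{|U|}\sum_{u\in U}u\in\mathbb{C}G$. Harish-Chandra restriction is $\mathrm{Resf}_L^G(M)=e_UM$ for a left $G$-module $M$. Harish-Chandra induction is $\mathrm{Indf}_L^G(W)=\mathbb{C}G\otimes_{\mathbb{C}P}\mathrm{Inf}(W)$ for a left $L$-module $W$, where $\mathrm{Inf}(W)$ is $W$ regarded as a $P$-module with $U$ acting trivially. With $\mathbf 1$ the trivial $G$-module, $$\mathcal{IR}_q^r=(\mathrm{Indf}_L^G\,\mathrm{Resf}_L^G)^r(\mathbf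 1),\qquad \mathcal{IR}_q^{r+\frac12}=\mathrm{Resf}_L^G(\mathcal{IR}_q^r)=e_U\mathcal{IR}_q^r .$$ For $g\in\mathbb{C}G$ and $v$ in a left $G$-module $M$, write $g\otimes_U v=g\otimes e_Uv\in\mathbb{C}G\otimes_{\mathbb{C}P}e_UM=\mathrm{Indf}_L^G\mathrm{Resf}_L^G(M)$; iterated expressions $g_1\otimes_Ug_2\otimes_U\cdots\otimes_Ug_r\otimes_U\mathbf 1$ (with $\mathbf 1$ also denoting a fixed nonzero vector of the trivial module) are bracketed to the right and lie in $\mathcal{IR}_q^r$. For $1\le i<j\le n$ and $t\in\mathbb{F}_q$, $x_{ij}(t)$ is the matrix with $t$ in position $(i,j)$, ones on the diagonal, and zeros elsewhere. $s_i$ is the permutation matrix of the transposition $(i,i+1)$, and $s_i(t)=x_{i,i+1}(t)s_i$. $\mathbb{Z}_n^r=\{(k_1,\ldots,k_r)\in\mathbb{Z}^r\mid 0\le k_1,\ldots,k_r\le n-1\}$. The $\ast$-height $k^*$ of $k\in\mathbb{Z}_n^r$ is defined by $k_1^*=0$ and $k_j^*=\min\{k_j,\max\{k_1^*+1,\ldots,k_{j-1}^*+1\}\}$ for $j\ge2$. Set $$\mathcal{P}_{n\times r}(q)=\{((k_1,a^{(1)}),\ldots,(k_r,a^{(r)}))\mid (k_1,\ldots,k_r)\in\mathbb{Z}_n^r,\ a^{(j)}\in\mathbb{F}_q^{\,k_j-k_j^*}\}.$$ For $0\le k^*\le k\le n-1$ and $a=(a_1,\ldots,a_{k-k^*})\in\mathbb{F}_q^{k-k^*}$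 put $$\overset{\ast}{w}_k(a)=s_k(a_{k-k^*})s_{k-1}(a_{k-k^*-1})\cdots s_{k^*+1}(a_1)\cdot\frac1{q^{k^*}}\sum_{b\in\mathbb{F}_q^{k^*}}s_{k^*}(b_{k^*})\cdots s_1(b_1)\in\mathbb{C}G$$ (empty products are $1$). For $K=((k_1,a^{(1)}),\ldots,(k_r,a^{(r)}))\in\mathcal{P}_{n\times r}(q)$ put $$v_K=\overset{\ast}{w}_{k_1}(a^{(1)})\otimes_U\overset{\ast}{w}_{k_2}(a^{(2)})\otimes_U\cdots\otimes_U\overset{\ast}{w}_{k_r}(a^{(r)})\otimes_U\mathbf 1,$$ where $\overset{\ast}{w}_{k_j}(a^{(j)})$ is formed using $k_j^*$, the $j$th entry of the $\ast$-height of $(k_1,\ldots,k_r)$. $[i]=\frac{q^i-1}{q-1}$, $S(r,\ell)$ is the Stirling number of the second kind, $d_{n,r}(q)=\sum_{\ell=1}^nS(r,\ell)[n][n-1]\cdots[n-\ell+1]$ for $r\ge1$, and $d_{n,0}(q)=1$. In part (b), $e_U\mathcal{IR}_q^r$ is identified with its image under $v\mapsto 1\otimes v$ in $\mathbb{C}G\otimes_{\mathbb{C}P}e_U\mathcal{IR}_q^r=\mathcal{IR}_q^{r+1}$. *)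

(* Defs.v *)
From HB Require Import structures.
From mathcomp Require Import all_boot all_order all_algebra all_fingroup.
From mathcomp Require Import reals complex.
Set Implicit Arguments.
Unset Strict Implicit.
Unset Printing Implicit Defensive.
Import GRing.Theory.
Local Open Scope ring_scope.

(* The quotient space V / Q, modelled on the chosen complement Q^C: [quotv_pi] *)
(* is the canonical projection (surjective with kernel Q), and [quotv_repr]    *)
(* picks a representative.                                                     *)
Section QuotientSpace.
Variables (C : fieldType) (V : vectType C) (Q : {vspace V}).

Definition quotv : vectType C := subvs_of (Q^C)%VS.
Definition quotv_pi : 'Hom(V, quotv) :=
  (linfun (vsproj (Q^C)%VS) \o daddv_pi (Q^C)%VS Q)%VF.
Definition quotv_repr : 'Hom(quotv, V) := linfun vsval.

Let complQ : ((Q^C) :&: Q = 0)%VS.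
Proof. by rewrite capvC capv_compl. Qed.

Lemma quotv_reprK x : quotv_pi (quotv_repr x) = x.
Proof.
by rewrite comp_lfunE !lfunE /= daddv_pi_id ?subvsP // vsvalK.
Qed.

Lemma quotv_pi_eq0 v : (quotv_pi v == 0) = (v \in Q).
Proof.
have Dv := @daddv_pi_add _ _ _ _ v complQ.
have {}Dv := Dv (ltac:(by rewrite addvC addv_complf memvf)).
rewrite comp_lfunE lfunE /= -val_eqE /= vsprojK ?memv_pi //.
apply/eqP/idP => [v0 | Qv].
  by rewrite -Dv v0 add0r memv_pi.
have : daddv_pi (Q^C)%VS Q v \in (Q^C :&: Q)%VS.
  by rewrite memv_cap memv_pi -(addrK (daddv_pi Q (Q^C)%VS v) (daddv_pi _ _ _))
             Dv memvB // memv_pi.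
by rewrite complQ memv0 => /eqP.
Qed.

Lemma quotv_piK v : quotv_repr (quotv_pi v) - v \in Q.
Proof. by rewrite -quotv_pi_eq0 linearB /= quotv_reprK subrr. Qed.

End QuotientSpace.

(* Finite-dimensional left C[H]-modules; as for [mx_repr], only the values of  *)
(* the action on H are relevant.                                               *)
Record gmodule (C : fieldType) (gT : finGroupType) (H : {group gT}) := GModule {
  gmod_sort :> vectType C;
  gact : gT -> 'End(gmod_sort);
  gact1 : gact 1%g = \1%VF;
  gactM : {in H &, forall x y, gact (x * y)%g = (gact x \o gact y)%VF}
}.
Arguments gact {C gT H} _ _.

Section GroupAlgebra.
Variables (C : fieldType) (gT : finGroupType).

(* Elements of the group algebra C[gT], as coefficient functions.  The ring    *)
(* product on {ffun gT -> C} is pointwise, hence the separate convolution      *)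
(* product [galg_mul].                                                         *)
Definition galg := {ffun gT -> C^o}.
HB.instance Definition _ := GRing.Lmodule.on galg.

Definition galg_of (g : gT) : galg := [ffun h => (h == g)%:R].

Definition galg_mul (x y : galg) : galg :=
  [ffun g => \sum_h (x h : C) * (y (h^-1 * g)%g : C)].

Definition galg_avg (A : {set gT}) : galg :=
  (#|A|%:R^-1 : C) *: \sum_(u in A) galg_of u.

Definition galg_act (M : gmodule C [group of [set: gT]]) (x : galg) : 'End(M) :=
  \sum_g (x g : C) *: gact M g.

Lemma galg_act_avg (M : gmodule C [group of [set: gT]]) (A : {set gT}) :
  galg_act M (galg_avg A) = (#|A|%:R^-1 : C) *: \sum_(u in A) gact M u.
Proof.
rewrite scaler_sumr [RHS]big_mkcond; apply: eq_bigr => g _.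
rewrite ffunE sum_ffunE.
have [Ag | Ag] := boolP (g \in A).
  rewrite (bigD1 g) //= big1 => [|u /andP[_ ug]]; rewrite ffunE.
    by rewrite eqxx addr0; congr (_ *: _); apply: mulr1.
  by rewrite eq_sym (negPf ug).
rewrite big1 => [|u Au]; first by rewrite scaler0 scale0r.
by rewrite ffunE; case: eqP Ag Au => // -> /negPf->.
Qed.

Lemma trivial_gactM : {in [group of [set: gT]] &, forall x y : gT,
  (\1 : 'End(C^o))%VF = (\1 \o \1)%VF}.
Proof. by move=> x y _ _; rewrite comp_lfun1l. Qed.

Definition trivial_gmodule : gmodule C [group of [set: gT]] :=
  @GModule C gT _ C^o (fun=> \1%VF) erefl trivial_gactM.

End GroupAlgebra.

(* C[gT] (x)_{C[H]} W, as the quotient of C[gT] (x)_C W = {ffun gT -> W} (the  *)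
(* tensor x (x) w being g |-> x g *: w) by the span of all                     *)
(* gh (x) w - g (x) hw with g in gT, h in H and w in W.                        *)
Section Induction.
Variables (C : fieldType) (gT : finGroupType) (H : {group gT}).
Variable W : gmodule C H.

Definition ptensor (x : galg C gT) (w : W) : {ffun gT -> W} :=
  [ffun g => (x g : C) *: w].

Fact ptensor_linear x : linear (ptensor x).
Proof.
move=> a v w; apply/ffunP=> g; rewrite !ffunE scalerDr !scalerA.
by rewrite mulrC.
Qed.
HB.instance Definition _ x := GRing.isSemilinear.Build _ _ _ _ (ptensor x)
  (GRing.semilinear_linear (ptensor_linear x)).

Definition tensor_rel : {vspace {ffun gT -> W}} :=
  (\sum_(g : gT) \sum_(h in H)
     limg (linfun (ptensor (galg_of C (g * h)))
           - (linfun (ptensor (galg_of C g)) \o gact W h))%VF)%VS.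

Definition ltrans (g : gT) (f : {ffun gT -> W}) : {ffun gT -> W} :=
  [ffun h => f (g^-1 * h)%g].

Fact ltrans_linear g : linear (ltrans g).
Proof. by move=> a u v; apply/ffunP=> h; rewrite !ffunE. Qed.
HB.instance Definition _ g := GRing.isSemilinear.Build _ _ _ _ (ltrans g)
  (GRing.semilinear_linear (ltrans_linear g)).

Lemma ltrans_ptensor g k w :
  ltrans g (ptensor (galg_of C k) w) = ptensor (galg_of C (g * k)) w.
Proof.
apply/ffunP=> h; rewrite !ffunE.
by rewrite -(inj_eq (mulgI g) (g^-1 * h)%g) mulKVg.
Qed.

Lemma tensor_relP g h w : h \in H ->
  ptensor (galg_of C (g * h)) w - ptensor (galg_of C g) (gact W h w)
    \in tensor_rel.
Proof.
move=> Hh; apply/(subvP (sumv_sup g _ (subvv _))) => //.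
apply/(subvP (sumv_sup h _ (subvv _))) => //.
apply/memv_imgP; exists w; rewrite ?memvf //.
by rewrite add_lfunE opp_lfunE comp_lfunE !lfunE.
Qed.

Lemma tensor_rel_ind (T : vectType C) (f : 'Hom({ffun gT -> W}, T))
    (Q : {vspace T}) :
  (forall g h w, h \in H ->
    f (ptensor (galg_of C (g * h)) w - ptensor (galg_of C g) (gact W h w)) \in Q) ->
  forall v, v \in tensor_rel -> f v \in Q.
Proof.
move=> fQ v relv.
suff /subvP/(_ v relv) : (tensor_rel <= f @^-1: Q)%VS by rewrite memv_preim.
apply/subv_sumP => g _; apply/subv_sumP => h Hh; apply/subvP => _ /memv_imgP[w _ ->].
by rewrite -memv_preim add_lfunE opp_lfunE comp_lfunE !lfunE; apply: fQ.
Qed.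

Definition evalf (h : gT) (f : {ffun gT -> W}) : W := f h.

Fact evalf_linear h : linear (evalf h).
Proof. by move=> a u v; rewrite /evalf !ffunE. Qed.
HB.instance Definition _ h := GRing.isSemilinear.Build _ _ _ _ (evalf h)
  (GRing.semilinear_linear (evalf_linear h)).

Definition ind_space : vectType C := quotv tensor_rel.

Definition tensor (x : galg C gT) (w : W) : ind_space :=
  quotv_pi tensor_rel (ptensor x w).

Fact tensor_linear x : linear (tensor x).
Proof. by move=> a v w; rewrite /tensor !linearP. Qed.
HB.instance Definition _ x := GRing.isSemilinear.Build _ _ _ _ (tensor x)
  (GRing.semilinear_linear (tensor_linear x)).

Lemma tensor_balanced g h w : h \in H ->
  tensor (galg_of C (g * h)) w = tensor (galg_of C g) (gact W h w).
Proof.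
move=> Hh; apply/eqP; rewrite -subr_eq0 /tensor -linearB quotv_pi_eq0.
exact: tensor_relP.
Qed.

Definition ind_act (g : gT) : 'End(ind_space) :=
  (quotv_pi tensor_rel \o linfun (ltrans g) \o quotv_repr tensor_rel)%VF.

Lemma ind_act_pi g v :
  ind_act g (quotv_pi tensor_rel v) = quotv_pi tensor_rel (ltrans g v).
Proof.
pose pi := quotv_pi tensor_rel; pose t := linfun (ltrans g).
have -> : ind_act g (pi v) = pi (t (quotv_repr tensor_rel (pi v))).
  by rewrite /ind_act !comp_lfunE.
have <- : t v = ltrans g v by rewrite lfunE.
apply/eqP; rewrite -subr_eq0 -!linearB quotv_pi_eq0.
apply: tensor_rel_ind; last exact: quotv_piK.
move=> k h w Hh; rewrite lfunE /= linearB /= !ltrans_ptensor mulgA.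
exact: tensor_relP.
Qed.

Lemma ind_act1 : ind_act 1 = \1%VF.
Proof.
apply/lfunP=> x; rewrite -[x]quotv_reprK ind_act_pi id_lfunE.
congr (quotv_pi _ _).
by apply/ffunP=> h; rewrite ffunE invg1 mul1g.
Qed.

Lemma ind_actM : {in [group of [set: gT]] &, forall x y,
  ind_act (x * y) = (ind_act x \o ind_act y)%VF}.
Proof.
move=> g k _ _; apply/lfunP=> x; rewrite -[x]quotv_reprK comp_lfunE !ind_act_pi.
by congr (quotv_pi _ _); apply/ffunP=> h; rewrite !ffunE invMg mulgA.
Qed.

Definition ind_gmodule : gmodule C [group of [set: gT]] :=
  GModule ind_act1 ind_actM.

(* w |-> 1 (x) w embeds W into the induced module. *)
Lemma tensor1_inj : injective (tensor (galg_of C 1)).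
Proof.
pose ev : 'Hom({ffun gT -> W}, W) :=
  \sum_(h in H) (gact W h \o linfun (evalf h))%VF.
have evE k w : ev (ptensor (galg_of C k) w) = if k \in H then gact W k w else 0.
  rewrite sum_lfunE; case: ifP => Hk.
    rewrite (bigD1 k) //= big1 ?addr0 => [|h /andP[_ /negPf hk]].
      by rewrite comp_lfunE lfunE /= /evalf !ffunE eqxx scale1r.
    by rewrite comp_lfunE lfunE /= /evalf !ffunE hk scale0r linear0.
  rewrite big1 // => h Hh; rewrite comp_lfunE lfunE /= /evalf !ffunE.
  by case: eqP Hk => [<-|_ _]; rewrite ?Hh // scale0r linear0.
have ev0 v : v \in tensor_rel -> ev v = 0.
  move=> relv; apply/eqP; rewrite -memv0; apply: tensor_rel_ind relv.
  move=> g h w Hh; rewrite memv0 linearB /= !evE groupMr // subr_eq0.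
  by case: ifP => // Hg; rewrite gactM // comp_lfunE.
move=> u v /eqP; rewrite -subr_eq0 -linearB /tensor quotv_pi_eq0 => /ev0.
rewrite evE group1 gact1 lfunE /= => /eqP.
by rewrite subr_eq0 => /eqP.
Qed.

Lemma ind_act_tensor1 h w : h \in H ->
  gact ind_gmodule h (tensor (galg_of C 1) w) = tensor (galg_of C 1) (gact W h w).
Proof.
by move=> Hh; rewrite /= ind_act_pi ltrans_ptensor mulg1 -[h in LHS]mul1g;
   exact: tensor_balanced.
Qed.

End Induction.

Section HarishChandra.
Variables (C : fieldType) (F : finFieldType) (n : nat).

(* Matrix positions are 0-based; {'GL_n[F]} is made of (n.-1.+1)-square        *)
(* matrices, so that n > 0 is assumed in the intended use.                     *)
Local Notation GLn := {'GL_n[F]}.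
Local Notation G := [group of [set: GLn]].
Local Notation I := 'I_n.-1.+1.

Definition Levi_set : {set GLn} :=
  [set g : GLn | [forall i : I, forall j : I,
     ((i == ord0) != (j == ord0)) ==> (GLval g i j == 0)]].

Definition unip_set : {set GLn} :=
  [set g : GLn | [forall i : I, forall j : I,
     ~~ ((i == ord0) && (j != ord0)) ==> (GLval g i j == (i == j)%:R)]].

Lemma Levi_setP (g : GLn) :
  reflect (forall i j : I, (i == ord0) != (j == ord0) -> GLval g i j = 0)
          (g \in Levi_set).
Proof.
rewrite inE; apply: (iffP forallP) => [gP i j ij | gP i].
  by apply/eqP; move/forallP/(_ j)/implyP: (gP i); apply.
by apply/forallP=> j; apply/implyP=> ij; rewrite gP.
Qed.

Lemma unip_setP (g : GLn) :
  reflect (forall i j : I, ~~ ((i == ord0) && (j != ord0)) ->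
             GLval g i j = (i == j)%:R)
          (g \in unip_set).
Proof.
rewrite inE; apply: (iffP forallP) => [gP i j ij | gP i].
  by apply/eqP; move/forallP/(_ j)/implyP: (gP i); apply.
by apply/forallP=> j; apply/implyP=> ij; rewrite gP.
Qed.

Lemma Levi_group_set : group_set Levi_set.
Proof.
apply/group_setP; split=> [|g h /Levi_setP gP /Levi_setP hP].
  apply/Levi_setP=> i j ij; rewrite GL_1E !mxE.
  by case: (i =P j) ij => // ->; rewrite eqxx.
apply/Levi_setP=> i j ij; rewrite GL_MxE mxE big1 // => k _.
have [ik|ik] := eqVneq (i == ord0) (k == ord0); last by rewrite gP ?mul0r.
by rewrite hP ?mulr0 // -ik.
Qed.
Canonical Levi := Group Levi_group_set.

Lemma unip_group_set : group_set unip_set.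
Proof.
apply/group_setP; split=> [|g h /unip_setP gP /unip_setP hP].
  by apply/unip_setP=> i j _; rewrite GL_1E !mxE.
apply/unip_setP=> i j ij; rewrite GL_MxE mxE.
have [i0 | i0] := eqVneq i ord0.
  have j0 : j = ord0 by apply/eqP; move: ij; rewrite i0 eqxx /= negbK.
  rewrite i0 j0 (bigD1 ord0) //= big1 ?addr0 => [|k k0].
    by rewrite gP ?hP ?eqxx ?mul1r.
  by rewrite hP ?(negPf k0) ?mulr0 ?andbF.
rewrite (bigD1 i) //= big1 ?addr0 => [|k ki].
  by rewrite gP ?(negPf i0) // hP ?(negPf i0) // eqxx mul1r.
by rewrite gP ?(negPf i0) // eq_sym (negPf ki) mul0r.
Qed.
Canonical unip := Group unip_group_set.

Lemma Levi_norm_unip : (Levi \subset 'N(unip))%g.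
Proof.
apply/subsetP=> l Ll; rewrite inE; apply/subsetP=> _ /imsetP[u Uu ->].
apply/unip_setP=> i j ij; move/unip_setP: Uu => uP.
have lP := elimT (Levi_setP _) Ll.
have lVP := elimT (Levi_setP _) (groupVr Ll).
have -> : GLval (u ^ l)%g i j =
    \sum_a GLval l^-1%g i a * (\sum_b (GLval u a b - (a == b)%:R) * GLval l b j)
      + (i == j)%:R.
  have -> : (i == j)%:R = GLval (l^-1 * l)%g i j by rewrite mulVg GL_1E mxE.
  rewrite conjgE !GL_MxE !mxE -big_split; apply: eq_bigr => a _.
  rewrite /= -mulrDr; congr (_ * _); rewrite ?mxE.
  have -> : GLval l a j = \sum_b (a == b)%:R * GLval l b j.
    rewrite (bigD1 a) //= eqxx mul1r big1 ?addr0 // => b ba.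
    by rewrite eq_sym (negPf ba) mul0r.
  by rewrite -big_split; apply: eq_bigr => b _; rewrite /= -mulrDl subrK.
rewrite big1 ?add0r // => a _; rewrite big_distrr big1 //= => b _.
have [/andP[/eqP a0 b0] | ab] := boolP ((a == ord0) && (b != ord0)); last first.
  by rewrite uP // subrr mul0r mulr0.
have [i0 | i0] := eqVneq i ord0; last by rewrite lVP ?mul0r // (negPf i0) a0.
rewrite i0 eqxx /= negbK in ij.
by rewrite [GLval l b j]lP ?mulr0 // ij (negPf b0).
Qed.

Lemma unip_Levi_TI : (unip :&: Levi = 1)%g.
Proof.
apply/trivgP/subsetP=> g /setIP[/unip_setP gU /Levi_setP gL]; apply/set1P.
apply: val_inj; apply/matrixP=> i j.
rewrite [RHS]mxE; change (GLval g i j = (i == j)%:R).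
have [/andP[/eqP i0 j0] | ij] := boolP ((i == ord0) && (j != ord0)); last exact: gU.
by rewrite gL ?i0 ?eqxx ?(negPf j0) // eq_sym (negPf j0).
Qed.

Lemma parab_group_set : group_set (Levi * unip)%g.
Proof. exact/comm_group_setP/normC/Levi_norm_unip. Qed.
Canonical parab := Group parab_group_set.

Lemma parabE : parab = (unip * Levi)%g :> {set GLn}.
Proof. exact/normC/Levi_norm_unip. Qed.

Lemma unip_normal : (unip <| parab)%g.
Proof.
by rewrite /normal mulG_subr mul_subG // ?normG // Levi_norm_unip.
Qed.

(* The factor l of lu, for l in L and u in U. *)
Definition Levi_part (p : GLn) : GLn := remgr unip Levi p.

Lemma Levi_part_mul l u : l \in Levi -> u \in unip -> Levi_part (l * u)%g = l.
Proof.
move=> Ll Uu; rewrite -[l in (l * _)%g](mulgK u) /Levi_part.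
rewrite mulgKV -[(l * u)%g](mulgKV l) remgrMid ?unip_Levi_TI // -mulgA.
by rewrite -[l in X in (X * _)%g]invgK -conjgE memJ_norm // groupV
           (subsetP Levi_norm_unip).
Qed.

Lemma Levi_part_in p : p \in parab -> Levi_part p \in Levi.
Proof. by move=> Pp; apply: mem_remgr; rewrite -parabE. Qed.

Lemma Levi_partM :
  {in parab &, forall x y, Levi_part (x * y)%g = (Levi_part x * Levi_part y)%g}.
Proof.
apply: remgrM unip_normal; apply/complP.
by split; rewrite ?parabE ?unip_Levi_TI.
Qed.

Section Restriction.
Variable M : gmodule C G.

Definition eU : 'End(M) := galg_act M (galg_avg C unip).

Lemma gact_eU l : l \in Levi -> (gact M l \o eU = eU \o gact M l)%VF.
Proof.
move=> Ll; apply/lfunP=> v.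
rewrite !comp_lfunE /eU galg_act_avg !scale_lfunE linearZ /=; congr (_ *: _).
rewrite !sum_lfunE linear_sum /= [RHS](reindex_inj (conjg_inj l^-1%g)) /=.
apply: eq_big => u.
  by rewrite memJ_norm // groupV (subsetP Levi_norm_unip).
by move=> _; rewrite -!comp_lfunE -!gactM ?inE // conjgE invgK -!mulgA mulVg mulg1.
Qed.

Definition res_space : vectType C := subvs_of (limg eU).
Definition res_proj (v : M) : res_space := vsproj (limg eU) (eU v).

Definition res_act (g : GLn) : 'End(res_space) :=
  (linfun (vsproj (limg eU)) \o gact M g \o linfun vsval)%VF.

Lemma res_actE l w : l \in Levi -> vsval (res_act l w) = gact M l (vsval w).
Proof.
move=> Ll; rewrite /res_act !comp_lfunE !lfunE /= vsprojK //.
have /memv_imgP[v _ ->] := subvsP w.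
by rewrite -comp_lfunE gact_eU // comp_lfunE memv_img ?memvf.
Qed.

Lemma res_act1 : res_act 1 = \1%VF.
Proof.
by apply/lfunP=> w; apply: val_inj; rewrite /= res_actE // gact1 !id_lfunE.
Qed.

Lemma res_actM :
  {in Levi &, forall x y, res_act (x * y) = (res_act x \o res_act y)%VF}.
Proof.
move=> x y Lx Ly; apply/lfunP=> w; apply: val_inj.
by rewrite /= res_actE ?groupM // comp_lfunE !res_actE // gactM ?inE // comp_lfunE.
Qed.

Definition Resf : gmodule C Levi := GModule res_act1 res_actM.

End Restriction.

Section Inflation.
Variable W : gmodule C Levi.

Definition inf_act (p : GLn) : 'End(W) := gact W (Levi_part p).

Lemma inf_act1 : inf_act 1 = \1%VF.
Proof. by rewrite /inf_act /Levi_part remgr1 ?gact1. Qed.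

Lemma inf_actM :
  {in parab &, forall x y, inf_act (x * y) = (inf_act x \o inf_act y)%VF}.
Proof.
by move=> x y Px Py; rewrite /inf_act Levi_partM // gactM ?Levi_part_in.
Qed.

Definition Inf : gmodule C parab := GModule inf_act1 inf_actM.

Definition Indf : gmodule C G := ind_gmodule Inf.

End Inflation.

Definition IR (r : nat) : gmodule C G :=
  iter r (fun M => Indf (Resf M)) (trivial_gmodule C GLn).

Definition IRhalf (r : nat) : gmodule C Levi := Resf (IR r).

(* The identification v |-> 1 (x) v of e_U IR^r with a subspace of IR^(r+1);   *)
(* it is injective (tensor1_inj) and L-equivariant (ind_act_tensor1).          *)
Definition IRhalf_emb (r : nat) : 'Hom(IRhalf r, IR r.+1) :=
  linfun (tensor (W := Inf (IRhalf r)) (galg_of C 1)).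

(* x (x)_U v = x (x) e_U v. *)
Definition tensorU (M : gmodule C G) (x : galg C GLn) (v : M) : Indf (Resf M) :=
  tensor (W := Inf (Resf M)) x (res_proj v).

Fixpoint iter_tensorU (r : nat) : r.-tuple (galg C GLn) -> IR r :=
  match r return r.-tuple (galg C GLn) -> IR r with
  | 0 => fun=> (1 : C^o)
  | r'.+1 => fun x => tensorU (thead x) (iter_tensorU (behead_tuple x))
  end.

(* [insubd] yields the given matrix when it is invertible: see xrootE, spermE. *)
Definition xroot (i j : I) (t : F) : GLn := insubd (1%g : GLn) (1%:M + t *: delta_mx i j : 'M_n.-1.+1).

Lemma xrootE i j t : i != j -> GLval (xroot i j t) = 1%:M + t *: delta_mx i j.
Proof.
move=> ij; rewrite [LHS]insubdK //.
suff /mulmx1_unit[] : (1%:M + t *: delta_mx i j) *m (1%:M - t *: delta_mx i j) = 1%:M.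
  by [].
rewrite mulmxDl mul1mx mulmxBr mulmx1 -scalemxAl -scalemxAr mul_delta_mx_0.
  by rewrite !scaler0 subr0 subrK.
by rewrite eq_sym.
Qed.

(* 1-based: the transposition (i, i+1) exchanges the positions i.-1 and i. *)
Definition sperm (i : nat) : GLn := insubd (1%g : GLn) (tperm_mx (inord i.-1) (inord i) : 'M_n.-1.+1).

Lemma spermE i : GLval (sperm i) = tperm_mx (inord i.-1) (inord i).
Proof. by rewrite insubdK // unitmx_perm. Qed.

Definition sgen (i : nat) (t : F) : GLn :=
  (xroot (inord i.-1) (inord i) t * sperm i)%g.

(* s_{m+d}(a_d) ... s_{m+1}(a_1) *)
Definition sgen_prod (m d : nat) (a : d.-tuple F) : GLn :=
  (\prod_(i < d) sgen (m + (rev_ord i).+1) (tnth a (rev_ord i)))%g.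

Definition wstar (k h : nat) (a : (k - h).-tuple F) : galg C GLn :=
  galg_mul (galg_of C (sgen_prod h a))
    (((#|F| ^ h)%:R^-1 : C) *: \sum_(b : h.-tuple F) galg_of C (sgen_prod 0 b)).

(* For the first entry, the maximum is over an empty list, hence 0. *)
Definition star_heights (s : seq nat) : seq nat :=
  foldl (fun hs k => rcons hs (minn k (\max_(h <- hs) h.+1))) [::] s.

Definition star_height (r : nat) (k : r.-tuple 'I_n) (j : 'I_r) : nat :=
  nth 0%N (star_heights [seq val i | i <- k]) j.

Definition Pnr (r : nat) : finType :=
  {k : r.-tuple 'I_n &
   {dffun forall j : 'I_r, (tnth k j - star_height k j).-tuple F}}.

Definition vK (r : nat) (K : Pnr r) : IR r :=
  iter_tensorU [tuple wstar (tagged K j) | j < r].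

End HarishChandra.

Definition stirling2 (r l : nat) : nat :=
  #|[set Q : {set {set 'I_r}} | partition Q [set: 'I_r] & #|Q| == l]|.

(* In rat, where the division is exact. *)
Definition qnum (q i : nat) : rat := (q%:R ^+ i - 1) / (q%:R - 1).

Definition dnr (n r q : nat) : rat :=
  if r is 0 then 1 else
  \sum_(1 <= l < n.+1) (stirling2 r l)%:R * \prod_(i < l) qnum q (n - i).

(* Main.v *)
(* Let V_h be the unipotent radical of the parabolic subgroup of block sizes      *)
(* 1, ..., 1, n - h (with h ones), so that V_0 = 1 and V_1 = U, and let e_h be    *)
(* the idempotent of V_h.  The lines with last nonzero coordinate k form, when    *)
(* k < h, one V_h-orbit, and when k >= h, q^(k-h) orbits indexed by the           *)
(* coordinates h, ..., k-1.  If g is the representative x s_k ... s_1 of such a   *)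
(* line, then U and the intersection of g^-1 V_h g with P act on e_U M through    *)
(* V_h', with h' = h if k < h and h' = h + 1 otherwise, whence                    *)
(*   e_h (g (x)_U v) = e_h (g (x)_U e_h' v)                                       *)
(* and e_h (CG (x)_CP e_U M) is the direct sum, over orbits, of copies of         *)
(* e_h' M.  As the *-heights follow the same recursion h -> h', the e_h v_K, with *)
(* *-heights started at h, form a basis of e_h IR^r by induction on r: the sum    *)
(* gives spanning and a lower bound for the dimension that equals the number of   *)
(* the v_K.  Grouping the K by the final value of h turns this number into the    *)
(* sum over Stirling numbers.  Part (a) is h = 0 and part (b) is h = 1.           *)

(* Linear independence of the $v_K$ is not proved directly: they span, and their number does not
   exceed the dimension. Both halves are inductions on $r$ that treat $e_h\mathcal{IR}_q^r$ for all
   $h$ at once, because one induction step passes from $e_h$ to $e_{h'}$.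

   Spanning is [avg_star_tensor_spanning]: [coset_rep_cover] reduces to vectors $e_h(g\otimes_U v)$,
   [avg_tensorU_avg] inserts $e_{h'}$ in front of $v$, and [avg_wstar] replaces $g$ by the averaged
   word. The lower bound is [leq_dim_limg_avg]: for $g$ over orbit representatives, the subspaces
   $e_h(g\otimes_U e_{h'}\mathcal{IR}_q^r)$ are independent ([coset_coef_neq]) and faithful copies
   of $e_{h'}\mathcal{IR}_q^r$ ([coset_coef_eq]). The group theory behind this is $g(V_{h'}\cap
   L)g^{-1}\subseteq V_h$ ([flag_unip_conjV]) for the insertion of $e_{h'}$, and $g^{-1}V_hg\cap
   P\subseteq V_{h'}$ ([flag_unip_conj]) for faithfulness.

   The number [indexed_count] obeys the same recursion $h\mapsto h'$, and [indexed_count_expand]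
   converts it into the Stirling sum. *)
From HB Require Import structures.
Require Import Defs.
From mathcomp Require Import all_boot all_order all_algebra all_fingroup.
From mathcomp Require Import reals complex zify.
Set Implicit Arguments.
Unset Strict Implicit.
Unset Printing Implicit Defensive.
Import GRing.Theory Num.Theory.
(* Otherwise [gact] and [gactM] would be those of fingroup's actions. *)
Import Defs.
Local Open Scope ring_scope.

(** * Set partitions and the number of indices *)

Section SetPartitions.
Local Open Scope nat_scope.
Variable T : finType.
Implicit Types (D A : {set T}) (Q : {set {set T}}) (x : T).

Definition partitions_of D l : {set {set {set T}}} :=
  [set Q | partition Q D & #|Q| == l].

Lemma partition_notin Q D x A : partition Q D -> x \notin D -> x \in A ->
  A \notin Q.
Proof.
by move=> pQ xD xA; apply: contra xD => /(partitionS pQ)/subsetP->.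
Qed.

(** Adding or deleting the block $\{x\}$ is a bijection. *)
Lemma card_partitions_singleton x D l : x \notin D ->
  #|[set Q in partitions_of (x |: D) l.+1 | [set x] \in Q]| =
  #|partitions_of D l|.
Proof.
move=> xD.
have Q0 Q : partition Q D -> [set x] \notin Q.
  by move=> pQ; apply: partition_notin pQ xD (set11 x).
rewrite -(card_in_imset (f := fun Q => [set x] |: Q)
    (D := partitions_of D l)); last first.
  move=> P Q; rewrite !inE => /andP[/Q0 xP _] /andP[/Q0 xQ _] eqPQ.
  by rewrite -(setU1K xP) eqPQ setU1K.
apply/esym/eq_card => Q; apply/imsetP/idP.
  case=> P; rewrite !inE => /andP[pP /eqP cP] ->.
  rewrite setU11 cardsU1 Q0 // cP eqxx !andbT; apply: partitionU1 => //.
    by apply/set0Pn; exists x; rewrite set11.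
  by rewrite disjoints1.
rewrite !inE -andbA => /and3P[pQ /eqP cQ xQ]; exists (Q :\ [set x]).
  rewrite (cardsD1 [set x] Q) xQ add1n in cQ; case: cQ => <-.
  by rewrite inE eqxx andbT -(setU1K xD); apply: partitionD1.
by rewrite setD1K.
Qed.

(** Deleting [x] from its block leaves a nonempty block $A$ of a partition $Q$ of [D]. Remembering
    $A$ makes the deletion reversible, so the partitions correspond to pairs $(Q,A)$ with $A\in Q$:
    the maps [f] and [g]. *)
Lemma card_partitions_nonsingleton x D l : x \notin D ->
  #|[set Q in partitions_of (x |: D) l.+1 | [set x] \notin Q]| =
  l.+1 * #|partitions_of D l.+1|.
Proof.
move=> xD.
pose X := [set p : {set {set T}} * {set T} |
  (p.1 \in partitions_of D l.+1) && (p.2 \in p.1)].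
pose f (p : {set {set T}} * {set T}) := (x |: p.2) |: (p.1 :\ p.2).
pose g Q := ((pblock Q x :\ x) |: (Q :\ pblock Q x), pblock Q x :\ x).
have fX p : p \in X ->
    [/\ partition (f p) (x |: D), x |: p.2 \notin p.1 :\ p.2 & x \notin p.2].
  case: p => Q A; rewrite !inE /f /= => /andP[/andP[pQ _] QA].
  have xA : x \notin A by apply: contra xD => /(subsetP (partitionS pQ QA)).
  have dA : [disjoint x |: A & D :\: A].
    rewrite -setI_eq0; apply/eqP/setP=> y; rewrite !inE.
    by case: (y \in A); rewrite ?andbF // orbF; case: eqP => // ->; rewrite (negPf xD).
  split=> //; last first.
    by rewrite negb_and (partition_notin pQ xD (setU11 _ _)) orbT.
  have -> : x |: D = (x |: A) :|: (D :\: A).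
    by rewrite -setUA -{1}(setID D A) (setIidPr (partitionS pQ QA)).
  apply: partitionU1 dA; first exact: partitionD1.
  by apply/set0Pn; exists x; rewrite setU11.
have gK : {in X, cancel f g}.
  move=> p Xp; have [pf np xp] := fX p Xp; case: p Xp pf np xp => Q A.
  rewrite inE /f /g /= => /andP[_ QA] pf nA xA.
  have -> : pblock ((x |: A) |: Q :\ A) x = x |: A.
    by apply: (def_pblock (partition_trivIset pf)); rewrite ?setU11.
  by rewrite (setU1K nA) (setU1K xA) setD1K.
have cX : #|X| = l.+1 * #|partitions_of D l.+1|.
  rewrite -sum1_card (eq_bigl (fun p => (p.1 \in partitions_of D l.+1)
     && (p.2 \in p.1))) => [|p]; last by rewrite inE.
  rewrite -(pair_big_dep (fun Q => Q \in partitions_of D l.+1)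
    (fun Q A => A \in Q) (fun _ _ => 1)) /=.
  rewrite (eq_bigr (fun=> l.+1)) => [|Q]; first by rewrite sum_nat_const mulnC.
  by rewrite inE sum1_card => /andP[_ /eqP].
rewrite -cX -(card_in_imset (can_in_inj gK)).
apply/esym/eq_card => Q; apply/imsetP/idP.
  case=> p Xp ->; have [pf np xp] := fX p Xp.
  move: Xp; rewrite inE => /andP[]; rewrite inE => /andP[pQ /eqP cQ] pp.
  rewrite (cardsD1 p.2) pp add1n in cQ; case: cQ => cQ.
  rewrite !inE pf cardsU1 np cQ eqxx.
  rewrite negb_or negb_and (partition_notin pQ xD (set11 x)) orbT /= andbT.
  apply/eqP=> /setP eqx; have [y py] : exists y, y \in p.2.
    by apply/set0Pn/(partition_neq0 pQ).
  have := eqx y; rewrite !inE py orbT => /eqP yx.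
  by rewrite -yx py in xp.
rewrite !inE -andbA => /and3P[pQ /eqP cQ xQ].
have xcQ : x \in cover Q by rewrite (cover_partition pQ) setU11.
set B := pblock Q x; have QB : B \in Q by apply: pblock_mem.
have xB : x \in B by rewrite mem_pblock.
have nB : B :\ x != set0.
  by apply: contra xQ => /eqP B0; rewrite -(setD1K xB) B0 setU0 in QB.
have sB : B \subset x |: D by apply: partitionS QB.
have pD : partition (B :\ x |: Q :\ B) D.
  have -> : D = (B :\ x) :|: ((x |: D) :\: B).
    apply/setP=> y; rewrite !inE; have := subsetP sB y; rewrite !inE.
    have [->|] := eqVneq; first by rewrite (negPf xD) xB.
    by case: (y \in B) => //= _ ->.
  apply: partitionU1 => //; first exact: partitionD1.
  by rewrite -setI_eq0; apply/eqP/setP=> y; rewrite !inE; case: (y \in B); rewrite ?andbF.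
have nQ : B :\ x \notin Q :\ B.
  apply/negP; rewrite in_setD1 => /andP[BB BQ]; have [y yB] := set0Pn _ nB.
  case/eqP: BB; rewrite -(def_pblock (partition_trivIset pQ) BQ yB).
  by apply: (def_pblock (partition_trivIset pQ) QB); case/setD1P: yB.
exists (g Q).
  rewrite /g -/B !inE eqxx /= andbT pD cardsU1 nQ.
  by rewrite (cardsD1 B) QB in cQ; rewrite cQ eqxx.
by rewrite /g /f -/B /= (setU1K nQ) !setD1K.
Qed.

End SetPartitions.

(** * Stirling recurrence and the recursion for the number of indices *)

Section Counting.
Local Open Scope nat_scope.

Fixpoint stirling2_rec (r l : nat) : nat :=
  match r, l with
  | 0, 0 => 1
  | r'.+1, l'.+1 => l * stirling2_rec r' l + stirling2_rec r' l'
  | _, _ => 0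
  end.

Lemma card_partitions (T : finType) (D : {set T}) l :
  #|partitions_of D l| = stirling2_rec #|D| l.
Proof.
have [r] := ubnP #|D|; elim: r => // r IHr in D l *.
have [->|[x Dx] lt_r] := set_0Vmem D.
  move=> _; rewrite cards0 /partitions_of.
  under eq_finset => Q do rewrite partition_set0.
  case: l => [|l] /=; last first.
    apply/eqP; rewrite cards_eq0; apply/eqP/setP=> Q; rewrite !inE.
    by case: eqP => // ->; rewrite cards0.
  rewrite -(cards1 (set0 : {set {set T}})); congr #|pred_of_set _|.
  apply/setP=> Q; rewrite !inE.
  by case: eqP => // ->; rewrite cards0.
have xD : x \notin D :\ x by rewrite !inE eqxx.
have lt_D : #|D :\ x| < r by rewrite (cardsD1 x) Dx in lt_r.
rewrite -(setD1K Dx) cardsU1 xD; case: l => [|l] /=.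
  apply/eqP; rewrite cards_eq0; apply/eqP/setP=> Q; rewrite !inE.
  apply/negP=> /andP[/cover_partition pQ]; rewrite cards_eq0 => /eqP Q0.
  by have := setU11 x (D :\ x); rewrite -pQ Q0 /cover big_set0 inE.
rewrite -(cardsID [set Q : {set {set T}} | [set x] \in Q]) addnC.
rewrite -!IHr // -(card_partitions_nonsingleton _ xD) -(card_partitions_singleton _ xD).
by congr (_ + _); apply: eq_card => Q; rewrite !inE andbC.
Qed.

Arguments stirling2_rec : simpl never.

Lemma stirling2_recS0 r : stirling2_rec r.+1 0 = 0.
Proof. by []. Qed.

Lemma stirling2_recSS r l :
  stirling2_rec r.+1 l.+1 = l.+1 * stirling2_rec r l.+1 + stirling2_rec r l.
Proof. by []. Qed.

Lemma stirling2E r l : stirling2 r l = stirling2_rec r l.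
Proof. by rewrite -[in RHS](card_ord r) -cardsT -card_partitions. Qed.

Definition qint (q m : nat) : nat := \sum_(i < m) q ^ i.

(* [h] stands for the bound max {k_1^* + 1, ..., k_(j-1)^* + 1} in the           *)
(* definition of k_j^*, and [k] for k_j; the result is the bound for k_(j+1)^*. *)
Definition next_height (h k : nat) : nat := maxn h (minn k h).+1.

Lemma next_height_lt h k : k < h -> next_height h k = h.
Proof. by rewrite /next_height; lia. Qed.

Lemma next_height_ge h k : h <= k -> next_height h k = h.+1.
Proof. by rewrite /next_height; lia. Qed.

(** The number of indices $K$ of length [r] when the bound for the $\ast$-heights starts at [h].
    Subtraction being truncated, [k - h] is $k-\min(k,h)$, the number of parameters of an entry
    [k]. *)
Fixpoint indexed_count (n q r h : nat) : nat :=
  if r is r'.+1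
  then \sum_(k < n) q ^ (k - h) * indexed_count n q r' (next_height h k)
  else 1.

(** Entries $k<h$ carry no parameter and keep [h]; entries $k\ge h$ raise it by one and contribute
    $\sum_k q^{k-h}=[n-h]$ in total. *)
Lemma indexed_countS n q r h : h <= n ->
  indexed_count n q r.+1 h =
  h * indexed_count n q r h + qint q (n - h) * indexed_count n q r h.+1.
Proof.
move=> le_hn /=; rewrite -(big_mkord xpredT
   (fun k => q ^ (k - h) * indexed_count n q r (next_height h k))).
rewrite (big_cat_nat (leq0n h) le_hn) /=; congr (_ + _).
  rewrite (eq_big_nat _ _ (F2 := fun=> indexed_count n q r h)).
    by rewrite sum_nat_const_nat subn0.
  by move=> k /andP[_ kh]; rewrite next_height_lt // (eqP (ltnW kh)) mul1n.
rewrite -{1}[h]add0n big_addn big_mkord /qint big_distrl /=.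
by apply: eq_bigr => i _; rewrite addnK next_height_ge ?leq_addl.
Qed.

(** The indices are grouped by the bound [h] reached after [r] entries. The [s] further entries make
    the induction possible: the first of them is moved into the head. *)
Lemma indexed_count_expand n q r s :
  indexed_count n q (r + s) 0 =
  \sum_(h < n.+1) stirling2_rec r h * \prod_(i < h) qint q (n - i)
                  * indexed_count n q s h.
Proof.
elim: r s => [|r IHr] s.
  by rewrite add0n big_ord_recl big_ord0 !mul1n big1 ?addn0.
rewrite addSnnS IHr.
under eq_bigr => h _.
  rewrite indexed_countS ?leq_ord // mulnDr.
  over.
(* The term [h = 0] of the first sum vanishes by its factor [h], the term [h = n] of the second
   because [qint q 0] is $0$; after a shift the rest is the Stirling recurrence. *)
rewrite big_split /= [X in X + _ = _]big_ord_recl [X in _ + X = _]big_ord_recr.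
rewrite [RHS]big_ord_recl /= stirling2_recS0 subnn [qint q 0]big_ord0 !mul0n !muln0 addn0 !add0n.
rewrite -big_split; apply: eq_bigr => h _.
rewrite -[bump 0 h]/(h.+1) !big_ord_recr stirling2_recSS mulnDl mulnDl.
congr (_ + _); rewrite -!mulnA // [RHS]mulnCA; congr (_ * _).
by rewrite [RHS]mulnCA; congr (_ * _); rewrite mulnCA.
Qed.

End Counting.

Lemma qnumE q m : (1 < q)%N -> qnum q m = (qint q m)%:R.
Proof.
move=> q_gt1; rewrite /qnum subrX1 mulrC mulKf.
  by rewrite natr_sum; apply: eq_bigr => i _; rewrite natrX.
by rewrite subr_eq0 pnatr_eq1; case: eqP q_gt1 => // ->.
Qed.

Lemma dnrE n r q : (1 < q)%N -> dnr n r q = (indexed_count n q r 0)%:R.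
Proof.
move=> q_gt1; case: r => // r.
rewrite -[r.+1 in RHS]addn0 indexed_count_expand big_ord_recl !mul0n add0n.
rewrite /dnr big_add1 big_mkord natr_sum; apply: eq_bigr => i _.
rewrite stirling2E muln1 natrM natr_prod; congr (_ * _).
by apply: eq_bigr => j _; rewrite qnumE.
Qed.

(** From bound $0$ every first entry raises the bound to $1$, which splits off the factor $[n]$. *)
Lemma dnrS_div n r q : (0 < n)%N -> (1 < q)%N ->
  dnr n r.+1 q / qnum q n = (indexed_count n q r 1)%:R.
Proof.
move=> n_gt0 q_gt1; rewrite dnrE // indexed_countS // add0n subn0 natrM.
rewrite qnumE // mulrC mulKf // pnatr_eq0 /qint.
by case: n n_gt0 => // n _; rewrite big_ord_recl.
Qed.

(** * Coset representatives and unipotent subgroups *)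

Section CosetRepresentatives.
Variables (F : finFieldType) (n : nat).
Local Notation N := n.-1.+1.
Local Notation GLn := {'GL_n[F]}.
Implicit Types (c : nat -> F) (g u l p z : GLn).

(** The word of [sgen_prod] with its parameters read from a function on [nat], so that words of
    different lengths concatenate without casts between tuple types. *)
Fixpoint sgen_word (m d : nat) c : GLn :=
  if d is d'.+1 then (sgen n (m + d) (c d') * sgen_word m d' c)%g else 1%g.

Lemma sgen_prodE m d (a : d.-tuple F) c :
  (forall i, tnth a i = c i) -> sgen_prod n m a = sgen_word m d c.
Proof.
move=> ac; rewrite /sgen_prod.
rewrite (eq_bigr (fun i : 'I_d => sgen n (m + (d - i)) (c (d - i).-1))); last first.
  by move=> i _; rewrite ac /= -subnS subnSK // subnS.
elim: d {a ac} => [|d IHd]; first by rewrite big_ord0.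
by rewrite big_ord_recl /= subn0 IHd; congr (_ * _)%g.
Qed.

Lemma sgen_word_cat m d e c :
  sgen_word m (d + e) c =
  (sgen_word (m + d) e (fun i => c (d + i)%N) * sgen_word m d c)%g.
Proof.
elim: e => [|e IHe]; first by rewrite addn0 mul1g.
by rewrite addnS /= IHe !addnS addnA mulgA.
Qed.

Lemma sgen_mull k t (A : 'M[F]_N) i j : (k.+1 < N)%N ->
  (GLval (sgen n k.+1 t) *m A) i j =
  if i == k :> nat then A (inord k.+1) j + t * A (inord k) j
  else if i == k.+1 :> nat then A (inord k) j else A i j.
Proof.
move=> kN; rewrite /sgen GL_MxE xrootE ?spermE; last first.
  by rewrite -val_eqE /= !inordK //; lia.
rewrite -mulmxA -xrowE mulmxDl mul1mx -scalemxAl !mxE.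
rewrite (bigD1 (inord k.+1)) //= big1 => [|a ak]; last first.
  by rewrite mxE (negPf ak) andbF mul0r.
rewrite !mxE /= eqxx andbT addr0 tpermR.
have [ik|ik] := eqVneq i (inord k).
  by rewrite ik inordK ?eqxx /= ?mul1r ?tpermL //; lia.
have -> : (i == k :> nat) = false.
  by apply: contraNF ik => /eqP <-; rewrite inord_val.
have [ik1|ik1] := eqVneq i (inord k.+1).
  by rewrite ik1 inordK ?eqxx ?mul0r ?mulr0 ?addr0 ?tpermR.
have -> : (i == k.+1 :> nat) = false.
  by apply: contraNF ik1 => /eqP <-; rewrite inord_val.
by rewrite mul0r mulr0 addr0 tpermD // eq_sym.
Qed.

Lemma sgen_mulr k t (A : 'M[F]_N) i j : (k.+1 < N)%N ->
  (A *m GLval (sgen n k.+1 t)) i j =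
  if j == k :> nat then A i (inord k.+1) + A i (inord k) * t
  else if j == k.+1 :> nat then A i (inord k) else A i j.
Proof.
move=> kN; rewrite /sgen GL_MxE xrootE ?spermE; last first.
  by rewrite -val_eqE /= !inordK //; lia.
rewrite mulmxA -xcolE mulmxDr mulmx1 -scalemxAr !mxE.
rewrite (bigD1 (inord k)) //= big1 => [|a ak]; last first.
  by rewrite mxE (negPf ak) mulr0.
rewrite !mxE /= eqxx addr0.
have [ik|ik] := eqVneq j (inord k).
  by rewrite ik inordK ?tpermL ?eqxx ?mulr1 1?mulrC //; lia.
have -> : (j == k :> nat) = false.
  by apply: contraNF ik => /eqP <-; rewrite inord_val.
have [ik1|ik1] := eqVneq j (inord k.+1).
  rewrite ik1 inordK // eqxx tpermR -val_eqE /= !inordK //; last by lia.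
  by rewrite ltn_eqF // mulr0 mulr0 addr0.
have -> : (j == k.+1 :> nat) = false.
  by apply: contraNF ik1 => /eqP <-; rewrite inord_val.
rewrite (_ : tperm _ _ j = j); last by rewrite tpermD // eq_sym.
by rewrite (negPf ik1) mulr0 mulr0 addr0.
Qed.

(* This is (1 + \sum_(i < k) c_i E_(i,k)) s_k ... s_1, with 0-based matrix      *)
(* positions; over k < n and c it runs through representatives of G / P.       *)
Definition coset_rep k c : GLn := sgen_word 0 k c.

Lemma coset_rep_mull k c (A : 'M[F]_N) i j : (k < N)%N ->
  (GLval (coset_rep k c) *m A) i j =
  if (i < k)%N then A (inord i.+1) j + c i * A ord0 j
  else if i == k :> nat then A ord0 j else A i j.
Proof.
elim: k i j A => [|k IHk] i j A kN.
  rewrite GL_1E mul1mx ltn0; case: eqP => // i0; congr (A _ _).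
  exact: val_inj.
rewrite [coset_rep _ _]/= GL_MxE -mulmxA sgen_mull ?add0n // !IHk ?(ltnW kN) //.
rewrite !inordK //; last by lia.
have -> : (k.+1 < k)%N = false by lia.
have -> : (k.+1 == k) = false by lia.
rewrite ltnn eqxx ltnS.
case: (ltngtP i k) => [ik|ik|ik] //=; last by rewrite ik.
by have -> : (i == k.+1 :> nat) = false by lia.
Qed.

Lemma coset_rep_mulr k c (A : 'M[F]_N) i j : (k < N)%N ->
  (A *m GLval (coset_rep k c)) i j =
  if j == 0 :> nat then A i (inord k) + \sum_(a < k) A i (inord a) * c a
  else if (j <= k)%N then A i (inord j.-1) else A i j.
Proof.
elim: k i j A => [|k IHk] i j A kN.
  rewrite GL_1E mulmx1 big_ord0 addr0 leqn0; case: eqP => // j0; congr (A _ _).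
  by apply: val_inj; rewrite /= inordK.
rewrite [coset_rep _ _]/= GL_MxE mulmxA IHk ?(ltnW kN) //.
rewrite !sgen_mulr ?add0n // big_ord_recr /=.
rewrite inordK ?(ltnW kN) // eqxx.
have [j0|j0] := eqVneq (j : nat) 0%N.
  rewrite -addrA [X in _ + X]addrC; congr (_ + (_ + _)).
  apply: eq_bigr => a _; rewrite sgen_mulr ?add0n // inordK; last first.
    by have := ltn_ord a; lia.
  by rewrite ltn_eqF // ltn_eqF // ltnW // ltnS.
have jN := ltn_ord j.
rewrite inordK; last by lia.
case: (ltngtP j k.+1) => [jk|jk|jk].
- rewrite -ltnS jk ltn_eqF; last by lia.
  by rewrite ltn_eqF; last by lia.
- by rewrite leqNgt (ltnW jk) /= gtn_eqF // ltnW.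
by rewrite jk ltnn gtn_eqF //= eqxx.
Qed.

End CosetRepresentatives.

(** * The groups $V_h$ and their orbits on $G/P$ *)

Section FlagUnipotent.
Variables (F : finFieldType) (n : nat).
Local Notation N := n.-1.+1.
Local Notation GLn := {'GL_n[F]}.
Implicit Types (c : nat -> F) (g u l p z : GLn) (A B : 'M[F]_N).

Definition flag_nilpotent (h : nat) A : Prop :=
  forall i j : 'I_N, ~~ ((i < h) && (i < j))%N -> A i j = 0.

(* The unipotent radical of the stabiliser of <e_1> < ... < <e_1, ..., e_h>. *)
Definition flag_unip_set (h : nat) : {set GLn} :=
  [set g : GLn | [forall i : 'I_N, forall j : 'I_N,
     ~~ ((i < h) && (i < j))%N ==> ((GLval g - 1%:M) i j == 0)]].

Lemma flag_unipP h g :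
  reflect (flag_nilpotent h (GLval g - 1%:M)) (g \in flag_unip_set h).
Proof.
rewrite inE; apply: (iffP forallP) => [gP i j ij | gP i].
  by apply/eqP; move/forallP/(_ j)/implyP: (gP i); apply.
by apply/forallP=> j; apply/implyP=> ij; rewrite gP.
Qed.

Lemma flag_unip_group_set h : group_set (flag_unip_set h).
Proof.
apply/group_setP; split=> [|g u /flag_unipP gP /flag_unipP uP].
  by apply/flag_unipP=> i j _; rewrite GL_1E subrr mxE.
apply/flag_unipP=> i j ij.
have -> : GLval (g * u)%g - 1%:M =
    (GLval g - 1%:M) *m (GLval u - 1%:M) + (GLval g - 1%:M) + (GLval u - 1%:M).
  rewrite GL_MxE mulmxBl mul1mx mulmxBr mulmx1.
  by rewrite addrAC subrK addrA subrK.
rewrite !mxE -[RHS](addr0 0); congr (_ + _); last first.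
  by have := uP i j ij; rewrite !mxE.
rewrite -[RHS](addr0 0); congr (_ + _); last first.
  by have := gP i j ij; rewrite !mxE.
apply: big1 => a _; have [ia|ia] := boolP ((i < h) && (i < a))%N.
  rewrite (uP a j) ?mulr0 //; apply: contra ij.
  by case/andP: ia => -> /ltn_trans ia /andP[_ /ia].
by rewrite gP // mul0r.
Qed.
Canonical flag_unip h := Group (flag_unip_group_set h).

Lemma flag_unip0 : flag_unip 0 = 1%G.
Proof.
apply/val_inj/setP=> g; rewrite /= in_set1; apply/flag_unipP/eqP=> [g1|->]; last by move=> i j _; rewrite GL_1E subrr mxE.
apply/val_inj/matrixP=> i j; have := g1 i j isT.
by rewrite mxE [X in _ + X]mxE => /eqP; rewrite subr_eq0 => /eqP.
Qed.

Lemma flag_unip1 : flag_unip 1 = unip F n.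
Proof.
apply/val_inj/setP=> g /=; apply/flag_unipP/unip_setP => gP i j ij.
  have /eqP : (GLval g - 1%:M) i j = 0.
    apply: gP; apply: contra ij; rewrite ltnS leqn0 -!val_eqE /=.
    by case/andP=> /eqP ->; rewrite lt0n.
  by rewrite !mxE subr_eq0 => /eqP.
rewrite !mxE gP ?subrr //; apply: contra ij.
by rewrite -!val_eqE /= => /andP[/eqP -> ]; rewrite !lt0n => ->.
Qed.

Lemma flag_unipS h h' : (h <= h')%N -> flag_unip h \subset flag_unip h'.
Proof.
move=> hh'; apply/subsetP=> g /flag_unipP gP; apply/flag_unipP=> i j ij.
apply: gP; apply: contra ij => /andP[ih ->].
by rewrite (leq_trans ih).
Qed.

(** $P$ is the stabiliser of the line spanned by the first basis vector. *)
Lemma parabP p :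
  reflect (forall i : 'I_N, i != ord0 -> GLval p i ord0 = 0) (p \in parab F n).
Proof.
apply: (iffP idP) => [/mulsgP[l u Ll Uu ->] i i0 | p0].
  rewrite GL_MxE mxE big1 // => a _.
  have [->|a0] := eqVneq a ord0.
    by rewrite (elimT (Levi_setP _) Ll) ?mul0r // (negPf i0).
  by rewrite (elimT (unip_setP _) Uu) ?(negPf a0) ?mulr0.
(* If $p=lu$, the first row of $u$ must be that of $p$ divided by $p_{00}$. So $u=1+e$, and $e^2=0$
   gives $u^{-1}=1-e$. *)
pose e : 'M[F]_N := \matrix_(i, j)
  (if (i == ord0) && (j != ord0) then GLval p ord0 j / GLval p ord0 ord0 else 0).
have ee : e *m e = 0.
  apply/matrixP=> i j; rewrite !mxE big1 // => a _; rewrite !mxE.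
  by have [->|a0] := eqVneq a ord0; rewrite ?andbF ?mul0r ?mulr0.
have ue : (1%:M + e) *m (1%:M - e) = 1%:M.
  by rewrite mulmxDl mul1mx mulmxBr mulmx1 ee subr0 subrK.
have [e1 e2] := mulmx1_unit ue.
pose u : GLn := insubd (1%g : GLn) (1%:M + e).
pose v : GLn := insubd (1%g : GLn) (1%:M - e).
have uE : GLval u = 1%:M + e by rewrite [LHS]insubdK.
have vE : GLval v = 1%:M - e by rewrite [LHS]insubdK.
have uv : (u * v = 1)%g by apply: val_inj; rewrite -[LHS]/(GLval _) GL_MxE uE vE ue.
have p00 : GLval p ord0 ord0 != 0.
  apply/negP=> /eqP p00; have := GL_1E n F.
  rewrite -(mulVg p) GL_MxE => /matrixP/(_ ord0 ord0)/eqP.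
  rewrite !mxE eqxx big1 ?(eq_sym 0) ?oner_eq0 // => a _.
  by have [->|a0] := eqVneq a ord0; rewrite ?p00 ?p0 ?mulr0.
have Uu : u \in unip F n.
  by apply/unip_setP=> i j /negPf ij; rewrite uE !mxE ij addr0.
apply/mulsgP; exists (p * v)%g u => //; last first.
  by rewrite -mulgA (_ : v = u^-1)%g ?mulVg ?mulg1 //; apply/esym/eqP; rewrite eq_invg_mul uv.
apply/Levi_setP=> i j ij; rewrite GL_MxE vE mulmxBr mulmx1.
rewrite mxE [X in _ + X]mxE mxE (bigD1 ord0) //= big1 ?addr0 => [|a a0]; last first.
  by rewrite mxE (negPf a0) mulr0.
rewrite mxE eqxx /=.
have [i0|i0] := eqVneq i ord0; last first.
  have j0 : j == ord0 by move: ij; rewrite (negPf i0); case: (j == ord0).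
  by rewrite (eqP j0) p0 // mul0r subr0.
have j0 : j != ord0 by move: ij; rewrite i0 eqxx; case: (j == ord0).
rewrite i0 j0.
by rewrite mulrC divfK // subrr.
Qed.

Lemma Levi_sub_parab : Levi F n \subset parab F n.
Proof. exact: mulG_subl. Qed.

Lemma flag_unip_sub_parab h : flag_unip h \subset parab F n.
Proof.
apply/subsetP=> g /flag_unipP gP; apply/parabP=> i i0.
by have := gP i ord0; rewrite ltn0 andbF !mxE (negPf i0) subr0; apply.
Qed.

(** For $h>0$ the factor in $U=V_1$ already lies in $V_h$, hence so does the other factor. *)
Lemma Levi_part_flag_unip h p : (0 < h)%N -> p \in flag_unip h ->
  Levi_part p \in flag_unip h.
Proof.
move=> h_gt0 Vp; have := subsetP (flag_unip_sub_parab h) p Vp.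
case/mulsgP=> l u Ll Uu Dp; rewrite Dp Levi_part_mul //.
have Vu : u \in flag_unip h.
  by apply: (subsetP (flag_unipS h_gt0)); rewrite flag_unip1.
by rewrite -(groupMr _ Vu) -Dp.
Qed.

(** Here $A=u-1$ and $B=z-1$ with $ug=gz$, so entries can be compared linearly. Multiplication by
    $g$ shifts rows and columns up to $k$ by one; this shift is what turns $h$ into $h+1$ when $h\le
    k$. *)
Lemma flag_nilpotent_conj h k c A B : (k < N)%N ->
  A *m GLval (coset_rep n k c) = GLval (coset_rep n k c) *m B ->
  flag_nilpotent h A -> (forall i : 'I_N, i != ord0 -> B i ord0 = 0) ->
  flag_nilpotent (next_height h k) B.
Proof.
move=> kN /matrixP AB A0 Bi0 i j ij.
(* Row $k$ of $gB$ is row $0$ of $B$, so $B_{00}$ is a combination of entries $A_{kj}$ with $j\le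
   k$. *)
have B00 : B ord0 ord0 = 0.
  have := AB (inord k) ord0; rewrite coset_rep_mull // coset_rep_mulr //.
  rewrite inordK // ltnn eqxx => <-; rewrite A0 ?inordK ?ltnn ?andbF // add0r big1 // => a _.
  by have ak := ltn_ord a; rewrite A0 ?mul0r // !inordK; lia.
have {Bi0} Bj0 i' : B i' ord0 = 0 by have [->|/Bi0] := eqVneq i' ord0.
have [j0|j0] := posnP j; first by rewrite (_ : j = ord0) //; apply: val_inj.
have [i0|i_gt0] := posnP i.
  by move: ij; rewrite i0 j0 /next_height; lia.
have iN := ltn_ord i; have jN := ltn_ord j.
have [ik|ki] := leqP i k.
  have := AB (inord i.-1) j; rewrite coset_rep_mull // coset_rep_mulr //.
  rewrite gtn_eqF // inordK; last by lia.
  have -> : (i.-1 < k)%N by lia.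
  have -> : inord i.-1.+1 = i :> 'I_N by rewrite (prednK i_gt0) inord_val.
  have [hk|kh] := leqP h k; last first.
    move: ij; rewrite next_height_lt // => ij; case: (leqP j k) => [jk|]; last by lia.
    rewrite A0; last by rewrite !inordK; lia.
    have := AB (inord k) j; rewrite coset_rep_mull // coset_rep_mulr //.
    rewrite inordK // ltnn eqxx gtn_eqF // jk => <-; rewrite A0; last by rewrite !inordK; lia.
    by rewrite mulr0 addr0.
  have -> : B ord0 j = 0.
    have := AB (inord k) j; rewrite coset_rep_mull // coset_rep_mulr //.
    rewrite inordK // ltnn eqxx gtn_eqF // => <-.
    by rewrite !A0 ?if_same // !inordK; lia.
  rewrite mulr0 addr0 => <-; move: ij; rewrite next_height_ge // => ij.
  by case: leqP => jk; rewrite A0 // !inordK; lia.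
have := AB i j; rewrite coset_rep_mull // coset_rep_mulr // gtn_eqF //.
have -> : (i < k)%N = false by lia.
have -> : (i == k :> nat) = false by lia.
move=> <-.
case: leqP => jk; rewrite A0 // ?inordK; try lia.
by move: ij; rewrite /next_height; lia.
Qed.

(** A converse for Levi elements, for which row $0$ of $B=l-1$ vanishes. *)
Lemma flag_nilpotent_conjV h k c A B : (k < N)%N ->
  A *m GLval (coset_rep n k c) = GLval (coset_rep n k c) *m B ->
  flag_nilpotent (next_height h k) B ->
  (forall j : 'I_N, B ord0 j = 0) ->
  flag_nilpotent h A.
Proof.
move=> kN /matrixP AB B0 B0j.
(* Columns $j<k$ of $A$ come first: column $k$ is only visible in column $0$ of $Ag$, mixed with
   them. *)
have Anear (i j : 'I_N) : (j < k)%N -> ~~ ((i < h) && (i < j))%N -> A i j = 0.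
  move=> jk ij; have := AB i (inord j.+1).
  rewrite coset_rep_mull // coset_rep_mulr // inordK; last by lia.
  rewrite jk /= inord_val => ->; have iN := ltn_ord i.
  case: ifP => ik; last by case: eqP => // _; rewrite B0 // inordK; move: ij; rewrite /next_height; lia.
  rewrite B0j mulr0 addr0 B0 // !inordK; last 2 first; try lia.
  by move: ij; rewrite /next_height; lia.
have Bi0 i : B i ord0 = 0.
  by apply: B0; rewrite ltn0 andbF.
move=> i j ij; have [jk|kj|jk] := ltngtP j k; first exact: Anear.
  have iN := ltn_ord i; have := AB i j.
  rewrite coset_rep_mull // coset_rep_mulr // gtn_eqF; last by lia.
  rewrite leqNgt kj /= => ->; rewrite B0j mulr0 addr0.
  case: ifP => ik; first by rewrite B0 // inordK; move: ij; rewrite /next_height; lia.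
  case: eqP => // ik'; apply: B0; move: ij; rewrite /next_height; lia.
have := AB i ord0; rewrite coset_rep_mull // coset_rep_mulr //= !Bi0 mulr0 addr0 !if_same.
rewrite -jk inord_val big1 ?addr0 // => a _; have aj := ltn_ord a.
by rewrite Anear ?mul0r // inordK; lia.
Qed.

Lemma flag_unip_conj h k c u z : (k < N)%N -> u \in flag_unip h ->
  z \in parab F n -> (u * coset_rep n k c = coset_rep n k c * z)%g ->
  z \in flag_unip (next_height h k).
Proof.
move=> kN /flag_unipP uP /parabP zP uz; apply/flag_unipP.
apply: (flag_nilpotent_conj (c := c) kN) uP _.
  by rewrite mulmxBl mulmxBr mul1mx mulmx1 -GL_MxE uz GL_MxE.
by move=> i i0; rewrite !mxE zP // (negPf i0) subr0.
Qed.

Lemma flag_unip_conjV h k c l : (k < N)%N -> l \in Levi F n ->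
  l \in flag_unip (next_height h k) ->
  (coset_rep n k c * l * (coset_rep n k c)^-1)%g \in flag_unip h.
Proof.
move=> kN /Levi_setP Ll /flag_unipP lP; apply/flag_unipP.
apply: (flag_nilpotent_conjV (c := c) kN _ lP).
  by rewrite mulmxBl mulmxBr mul1mx mulmx1 -GL_MxE mulgKV GL_MxE.
move=> j; have [->|j0] := eqVneq j ord0; first by rewrite lP // ltnn andbF.
by rewrite !mxE Ll ?(negPf j0) // eq_sym (negPf j0) subr0.
Qed.

(** For $u=gg'^{-1}$, the matrix $(u-1)g'=g-g'$ lives in column $0$. Hence $u-1$ lives in column
    $k$, with entries $c_i-c'_i$ for $i<k$, and these vanish for $i\ge h$. *)
Lemma coset_rep_unip h k c c' : (k < N)%N ->
  (forall i, (h <= i < k)%N -> c i = c' i) ->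
  (coset_rep n k c * (coset_rep n k c')^-1)%g \in flag_unip h.
Proof.
move=> kN cc'; apply/flag_unipP; set u := (_ * _)%g.
pose D : 'M[F]_N := GLval (coset_rep n k c) - GLval (coset_rep n k c').
have AD : (GLval u - 1%:M) *m GLval (coset_rep n k c') = D.
  by rewrite mulmxBl mul1mx -GL_MxE mulgKV.
have DE i j : D i j = if (i < k)%N && (j == ord0) then c i - c' i else 0.
  rewrite mxE [X in _ + X]mxE -[GLval (coset_rep n k c)]mulmx1.
  rewrite -[GLval (coset_rep n k c')]mulmx1 !coset_rep_mull // !mxE.
  case: (i < k)%N; last by rewrite subrr.
  by rewrite (eq_sym ord0 j); case: (j == ord0); rewrite ?mulr0 ?addr0 ?subrr //= !mulr1 opprD addrACA subrr add0r.
have A0 (i j : 'I_N) : j != k :> nat -> (GLval u - 1%:M) i j = 0.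
  move=> jk; have jN := ltn_ord j; have [j_lt|j_ge] := ltnP j k.
    have := congr1 (fun M : 'M_N => M i (inord j.+1)) AD.
    rewrite coset_rep_mulr // inordK; last by lia.
    rewrite j_lt /= inord_val => ->; rewrite DE -val_eqE /= inordK ?andbF //; lia.
  have := congr1 (fun M : 'M_N => M i j) AD.
  rewrite coset_rep_mulr // gtn_eqF; last by lia.
  rewrite leqNgt ltn_neqAle eq_sym jk j_ge /= => ->.
  by rewrite DE -val_eqE /= gtn_eqF ?andbF //; lia.
move=> i j ij; have [jk|] := eqVneq (j : nat) k; last exact: A0.
have := congr1 (fun M : 'M_N => M i ord0) AD.
rewrite coset_rep_mulr // -jk inord_val big1 => [|a _]; last first.
  by have aj := ltn_ord a; have jN := ltn_ord j; rewrite A0 ?mul0r // inordK; lia.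
rewrite /= addr0 => ->; rewrite DE eqxx andbT; case: ifP => // ik.
by rewrite cc' ?subrr //; lia.
Qed.

Lemma coset_rep_col0 k c i : (k < N)%N ->
  GLval (coset_rep n k c) i ord0 =
  if (i < k)%N then c i else (i == k :> nat)%:R.
Proof.
move=> kN; rewrite -[GLval _]mulmx1 coset_rep_mull // !mxE eqxx mulr1.
have := ltn_ord i; rewrite -!val_eqE /= => iN; case: ifP => ik.
  by rewrite inordK ?add0r //; lia.
by case: ifP => // ik'; have -> : (i == 0 :> nat) = false by lia.
Qed.

(** Take for [k] the last nonzero coordinate of the first column of [g], and for [c] the coordinates
    above it after scaling that one to $1$. *)
Lemma coset_rep_cover g : exists k c,
  (k < N)%N /\ ((coset_rep n k c)^-1 * g)%g \in parab F n.
Proof.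
have [i gi0] : exists i : 'I_N, GLval g i ord0 != 0.
  apply/existsP; apply: contraT => /existsPn g0.
  have := GL_1E n F; rewrite -(mulVg g) GL_MxE => /matrixP/(_ ord0 ord0)/eqP.
  rewrite !mxE eqxx big1 ?(eq_sym 0) ?oner_eq0 // => a _.
  by have := g0 a; rewrite negbK => /eqP ->; rewrite mulr0.
case: (@arg_maxnP _ i (fun i => GLval g i ord0 != 0) val gi0) => k gk0 k_max.
pose c i := GLval g (inord i) ord0 / GLval g k ord0.
exists k, c; split=> //; set p := (_ * _)%g.
have Dg : GLval g = GLval (coset_rep n k c) *m GLval p by rewrite -GL_MxE mulKVg.
have pk : GLval p ord0 ord0 = GLval g k ord0.
  by rewrite [in RHS]Dg coset_rep_mull // ltnn eqxx.
apply/parabP=> j; rewrite -val_eqE /= => j0; have jN := ltn_ord j.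
have [jk|kj] := leqP j k.
  have := congr1 (fun M : 'M_N => M (inord j.-1) ord0) Dg.
  rewrite coset_rep_mull // inordK; last by lia.
  have -> : (j.-1 < k)%N by lia.
  have -> : inord j.-1.+1 = j :> 'I_N by rewrite (@prednK j) ?lt0n ?inord_val.
  rewrite pk /c divfK // => /eqP; rewrite eq_sym -subr_eq0 addrK => /eqP //.
have := congr1 (fun M : 'M_N => M j ord0) Dg.
rewrite coset_rep_mull //.
have -> : (j < k)%N = false by lia.
have -> : (j == k :> nat) = false by lia.
move=> <-; by apply/eqP; apply: contraTT kj => /k_max; rewrite -leqNgt.
Qed.

(** The first columns of $ug$ and $g'$ span the same line. As $u$ changes only coordinates below
    both $h$ and $k$, the last nonzero coordinates agree, the proportionality factor is $1$, and so
    coordinates $h,\ldots,k-1$ agree. *)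
Lemma coset_rep_inj h k k' c c' u : (k < N)%N -> (k' < N)%N ->
  u \in flag_unip h ->
  ((coset_rep n k' c')^-1 * u * coset_rep n k c)%g \in parab F n ->
  k = k' /\ (forall i, (h <= i < k)%N -> c i = c' i).
Proof.
move=> kN k'N /flag_unipP uP; set p := (_ * _)%g => /parabP p0.
have up i : (GLval u *m GLval (coset_rep n k c)) i ord0 =
    GLval (coset_rep n k' c') i ord0 * GLval p ord0 ord0.
  rewrite -GL_MxE (_ : (u * _ = coset_rep n k' c' * p)%g); last first.
    by rewrite /p -mulgA mulKVg.
  rewrite GL_MxE mxE (bigD1 ord0) //= big1 ?addr0 // => a a0.
  by rewrite p0 // mulr0.
have uE (i : 'I_N) : (k <= i)%N || (h <= i)%N ->
    (GLval u *m GLval (coset_rep n k c)) i ord0 = GLval (coset_rep n k c) i ord0.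
  move=> ik; rewrite -[GLval u](subrK 1%:M) mulmxDl mul1mx mxE.
  rewrite mxE big1 ?add0r // => a _; have [ia|ia] := boolP ((i < h) && (i < a))%N.
    rewrite coset_rep_col0 // ifN ?gtn_eqF ?mulr0 //; lia.
  by rewrite uP // mul0r.
have upk : GLval (coset_rep n k' c') (inord k) ord0 * GLval p ord0 ord0 = 1.
  by rewrite -up uE ?inordK ?leqnn // coset_rep_col0 // inordK // ltnn eqxx.
have kk' : (k <= k')%N.
  rewrite leqNgt; apply/negP=> kk'; move: upk.
  rewrite coset_rep_col0 // inordK // ltnNge ltnW //= gtn_eqF // mul0r => /esym/eqP.
  by rewrite oner_eq0.
have k'k : (k' <= k)%N.
  rewrite leqNgt; apply/negP=> k'k; have := up (inord k').
  rewrite uE ?inordK ?(ltnW k'k) // !coset_rep_col0 // !inordK // ltnn eqxx mul1r.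
  have -> : (k' < k)%N = false by lia.
  have -> : (k' == k) = false by lia.
  move=> p00; rewrite -p00 mulr0 in upk.
  by move/eqP: upk; rewrite eq_sym oner_eq0.
have ek : k = k' by apply/eqP; rewrite eqn_leq kk'.
split=> // i /andP[hi ik].
have p00 : GLval p ord0 ord0 = 1.
  by move: upk; rewrite coset_rep_col0 // inordK // -ek ltnn eqxx mul1r.
have iN : (i < N)%N by lia.
have := up (inord i); rewrite uE ?inordK ?hi ?orbT // !coset_rep_col0 // inordK // -ek ik.
by rewrite p00 mulr1.
Qed.

End FlagUnipotent.

(** * One step of induction and restriction *)

Section Averaging.
Variables (C : numFieldType) (gT : finGroupType).
Variable M : gmodule C [group of [set: gT]].
Implicit Types (V : {group gT}) (v : M).

Lemma gactMv x y v : gact M (x * y)%g v = gact M x (gact M y v).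
Proof. by rewrite gactM ?inE // comp_lfunE. Qed.

Definition avg V : 'End(M) := galg_act M (galg_avg C V).

Lemma avgE V v : avg V v = (#|V|%:R^-1 : C) *: \sum_(u in V) gact M u v.
Proof. by rewrite /avg galg_act_avg scale_lfunE sum_lfunE. Qed.

Lemma card_group_neq0 V : #|V|%:R != 0 :> C.
Proof. by rewrite pnatr_eq0 -lt0n cardG_gt0. Qed.

Lemma avg_gact V u v : u \in V -> avg V (gact M u v) = avg V v.
Proof.
move=> Vu; rewrite !avgE; congr (_ *: _).
rewrite [RHS](reindex_inj (mulIg u)) /=; apply: eq_big => x.
  by rewrite groupMr.
by rewrite gactMv.
Qed.

Lemma gact_avg V u v : u \in V -> gact M u (avg V v) = avg V v.
Proof.
move=> Vu; rewrite !avgE linearZ linear_sum /=; congr (_ *: _).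
rewrite [RHS](reindex_inj (mulgI u)) /=; apply: eq_big => x.
  by rewrite groupMl.
by rewrite gactMv.
Qed.

Lemma avg_fixed V v : {in V, forall u, gact M u v = v} -> avg V v = v.
Proof.
move=> Vv; rewrite avgE (eq_bigr (fun=> v)) // sumr_const -scaler_nat scalerA.
by rewrite mulVf ?scale1r ?card_group_neq0.
Qed.

Lemma avg_subr V (W : {group gT}) v : W \subset V -> avg W (avg V v) = avg V v.
Proof.
by move=> /subsetP WV; apply: avg_fixed => u /WV Vu; apply: gact_avg.
Qed.

Lemma avg_trivial v : avg 1%G v = v.
Proof.
by apply: avg_fixed => u /set1P ->; rewrite gact1 id_lfunE.
Qed.

End Averaging.

Section InducedModule.
Variables (C : fieldType) (gT : finGroupType) (H : {group gT}).
Variable W : gmodule C H.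

Lemma tensor_scale_suml (I : Type) (s : seq I) (P : pred I) (a : C)
    (x : I -> galg C gT) (w : W) :
  tensor (a *: \sum_(i <- s | P i) x i) w = a *: \sum_(i <- s | P i) tensor (x i) w.
Proof.
rewrite /tensor -linear_sum -linearZ /=; congr (quotv_pi _ _).
apply/ffunP=> g; rewrite !ffunE !sum_ffunE -scalerA.
congr (_ *: _); rewrite (eq_bigr (fun i => (x i g : C) *: w)) => [|i _].
  exact: scaler_suml.
by rewrite ffunE.
Qed.

Lemma gact_tensor g k w :
  gact (ind_gmodule W) g (tensor (galg_of C k) w) = tensor (galg_of C (g * k)%g) w.
Proof. by rewrite /= ind_act_pi ltrans_ptensor. Qed.

Lemma tensor_decomp (v : ind_gmodule W) :
  exists w : gT -> W, v = \sum_g tensor (galg_of C g) (w g).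
Proof.
exists (quotv_repr (tensor_rel W) v); rewrite -[LHS]quotv_reprK /tensor -linear_sum.
congr (quotv_pi _ _); apply/ffunP=> g; rewrite sum_ffunE (bigD1 g) //=.
rewrite big1 ?addr0 => [|h hg]; rewrite !ffunE ?eqxx ?scale1r //.
by rewrite eq_sym (negPf hg) scale0r.
Qed.

(* The component of [1 (x) W] in the decomposition of the induced module into *)
(* the [g (x) W], for [g] ranging over coset representatives.                 *)
Definition ind_coef : 'Hom(ind_space W, W) :=
  ((\sum_(h in H) (gact W h \o linfun (evalf h))) \o quotv_repr (tensor_rel W))%VF.

(** The sum over [H] kills the tensor relations, so the choice of representative does not matter. *)
Lemma ind_coef_tensor k w :
  ind_coef (tensor (galg_of C k) w) = if k \in H then gact W k w else 0.
Proof.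
set ev : 'Hom({ffun gT -> W}, W) := (\sum_(h in H) (gact W h \o linfun (evalf h)))%VF.
have evE g v : ev (ptensor (galg_of C g) v) = if g \in H then gact W g v else 0.
  have evh h : (gact W h \o linfun (evalf h))%VF (ptensor (galg_of C g) v) =
      if h == g then gact W g v else 0.
    rewrite comp_lfunE lfunE /= /evalf !ffunE.
    by case: eqP => [->|_]; rewrite ?scale1r // scale0r linear0.
  rewrite sum_lfunE; under eq_bigr do rewrite evh.
  case: ifPn => gH.
    by rewrite (bigD1 g) //= eqxx big1 ?addr0 // => h /andP[_ /negPf ->].
  by rewrite big1 // => h hH; case: eqP gH => // <-; rewrite hH.
rewrite /ind_coef comp_lfunE -/ev -evE; apply/eqP; rewrite -subr_eq0 -linearB -memv0.
apply: tensor_rel_ind (quotv_piK _ _) => g h v Hh.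
by rewrite memv0 linearB /= !evE groupMr // subr_eq0; case: ifP => // Hg; rewrite gactM // comp_lfunE.
Qed.

End InducedModule.

Section HarishChandraStep.
Variables (C : numFieldType) (F : finFieldType) (n : nat).
Local Notation N := n.-1.+1.
Local Notation GLn := {'GL_n[F]}.
Variable M : gmodule C [group of [set: GLn]].
Local Notation IM := (Indf (Resf M)).
Local Notation dl g := (galg_of C g).
Implicit Types (g u l p : GLn) (v : M) (c : nat -> F).

Fact tensorU_linear x : linear (tensorU (M := M) x).
Proof. by move=> a v w; rewrite /tensorU /res_proj !linearP. Qed.
HB.instance Definition _ x := GRing.isSemilinear.Build _ _ _ _ (tensorU (M := M) x)
  (GRing.semilinear_linear (tensorU_linear x)).

Lemma val_res_proj v : vsval (res_proj v) = eU M v.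
Proof. by rewrite vsprojK // memv_img ?memvf. Qed.

Lemma res_projK (w : Resf M) : res_proj (vsval w : M) = w.
Proof.
apply: val_inj; rewrite -[LHS]/(vsval (res_proj _)) val_res_proj.
have /memv_imgP[v _ Dw] := subvsP w.
by apply: (etrans _ (esym Dw)); rewrite Dw [LHS]avg_subr.
Qed.

Lemma tensorU_eU x v : tensorU x (eU M v) = tensorU x v.
Proof.
have eUK : eU M (eU M v) = eU M v by apply: avg_subr.
by rewrite /tensorU /res_proj eUK.
Qed.

Lemma gact_tensorU g k v : gact IM g (tensorU (dl k) v) = tensorU (dl (g * k)%g) v.
Proof. exact: gact_tensor. Qed.

Lemma tensorU_Levi g l v : l \in Levi F n ->
  tensorU (dl (g * l)%g) v = tensorU (dl g) (gact M l v).
Proof.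
move=> Ll; rewrite /tensorU tensor_balanced; last exact: (subsetP (Levi_sub_parab F n)).
congr (tensor _ _); apply: val_inj.
rewrite -[LHS]/(vsval (res_act M (Levi_part l) (res_proj v))).
rewrite -{1}[l]mulg1 Levi_part_mul ?group1 // res_actE //.
by rewrite -[RHS]/(vsval (res_proj _)) !val_res_proj -!comp_lfunE gact_eU.
Qed.

Lemma tensorU_unip g u v : u \in unip F n ->
  tensorU (dl g) (gact M u v) = tensorU (dl g) v.
Proof.
move=> Uu; have Euv : eU M (gact M u v) = eU M v by apply: avg_gact.
by rewrite /tensorU /res_proj Euv.
Qed.

(** The factor of [u] in $U$ is absorbed by $e_U$; the Levi factor moves across the tensor sign. *)
Lemma tensorU_flag_unip h g u v : (0 < h)%N -> u \in flag_unip F n h ->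
  tensorU (dl g) (gact M u v) = tensorU (dl (g * Levi_part u)%g) v.
Proof.
move=> h_gt0 Vu; have := subsetP (flag_unip_sub_parab F n h) u Vu.
case/mulsgP=> l w Ll Uw Du; rewrite Du Levi_part_mul // gactMv.
by rewrite -tensorU_Levi // tensorU_unip.
Qed.

Lemma tensorU_spanning (Q : {vspace IM}) (x : IM) :
  (forall k c v, (k < N)%N -> tensorU (dl (coset_rep n k c)) v \in Q) -> x \in Q.
Proof.
move=> Qv; have [w ->] := tensor_decomp x; apply: memv_suml => g _.
have [k [c [kN Pg]]] := coset_rep_cover g.
rewrite -[g](mulKVg (coset_rep n k c)) tensor_balanced //.
rewrite -[gact _ _ _](res_projK).
exact: Qv.
Qed.

(** Parameters are numbered as the coordinates of the line, the first being [c h]. Completed by the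
    averaged values below [h], they form the parameters of one [coset_rep]. *)
Definition wstar_of k h c : galg C GLn :=
  wstar C n (k := k) (h := h) [tuple c (h + i)%N | i < k - h].

Lemma galg_mul_of g k : galg_mul (dl g) (dl k) = dl (g * k)%g.
Proof.
apply/ffunP=> x; rewrite !ffunE (bigD1 g) //= big1 => [|h hg].
  by rewrite !ffunE eqxx mul1r addr0 -(inj_eq (mulgI g)) mulKVg.
by rewrite !ffunE (negPf hg) mul0r.
Qed.

Lemma galg_mul_sumr (I : finType) (x : galg C GLn) (a : C) (y : I -> galg C GLn) :
  galg_mul x (a *: \sum_i y i) = a *: \sum_i galg_mul x (y i).
Proof.
apply/ffunP=> g; rewrite !ffunE sum_ffunE.
under eq_bigr => h _.
  rewrite !ffunE sum_ffunE [X in _ * X](_ : _ = a * \sum_i (y i (h^-1 * g)%g : C)) //.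
  rewrite mulrCA mulr_sumr.
  over.
rewrite -mulr_sumr exchange_big /=; congr (_ * _); apply: eq_bigr => i _.
by rewrite ffunE.
Qed.

(* The elements averaged in w* differ by left factors in [flag_unip F n h]. *)
Lemma avg_wstar h k c v : (k < N)%N ->
  avg IM (flag_unip F n h) (tensorU (wstar_of k (minn k h) c) v) =
  avg IM (flag_unip F n h) (tensorU (dl (coset_rep n k c)) v).
Proof.
move=> kN; set hk := minn k h; have hkk : (hk <= k)%N by rewrite geq_minl.
rewrite /wstar_of /wstar galg_mul_sumr /tensorU tensor_scale_suml.
rewrite linearZ linear_sum /=.
rewrite (eq_bigr (fun=> avg IM (flag_unip F n h) (tensorU (dl (coset_rep n k c)) v))).
  rewrite sumr_const card_tuple -scaler_nat scalerA mulVf ?scale1r // pnatr_eq0 -lt0n.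
  by rewrite expn_gt0; apply/orP; left; apply/card_gt0P; exists 0.
move=> b _; rewrite galg_mul_of.
pose c' i := if (i < hk)%N then nth 0 b i else c i.
have -> : (sgen_prod n hk [tuple c (hk + i)%N | i < k - hk] * sgen_prod n 0 b)%g =
    coset_rep n k c'.
  rewrite (@sgen_prodE _ _ _ _ _ (fun i => c' (hk + i)%N)); last first.
    by move=> i; rewrite tnth_mktuple /c' ltnNge leq_addr.
  rewrite (@sgen_prodE _ _ _ _ _ c'); last first.
    by move=> i; rewrite /c' ltn_ord (tnth_nth 0).
  by rewrite /coset_rep -[in RHS](subnKC hkk) sgen_word_cat add0n.
have Vu : (coset_rep n k c' * (coset_rep n k c)^-1)%g \in flag_unip F n h.
  by apply: coset_rep_unip => // i ik; rewrite /c' ifN //; lia.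
rewrite -[in RHS](avg_gact _ Vu); congr (avg IM _ _).
by rewrite gact_tensorU mulgKV.
Qed.

(** For $y\in V_{h'}$ with Levi part $l$, $g\otimes_U yv=(glg^{-1})(g\otimes_U v)$, and $e_h$
    absorbs $glg^{-1}\in V_h$. So all terms of the average over $V_{h'}$ agree. *)
Lemma avg_tensorU_avg h k c v : (k < N)%N ->
  avg IM (flag_unip F n h) (tensorU (dl (coset_rep n k c)) v) =
  avg IM (flag_unip F n h)
    (tensorU (dl (coset_rep n k c)) (avg M (flag_unip F n (next_height h k)) v)).
Proof.
move=> kN; set V' := flag_unip F n (next_height h k).
have h'_gt0 : (0 < next_height h k)%N by rewrite /next_height; lia.
rewrite (avgE V') linearZ linear_sum linearZ linear_sum /=.
rewrite (eq_bigr (fun=> avg IM (flag_unip F n h) (tensorU (dl (coset_rep n k c)) v))).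
  by rewrite sumr_const -scaler_nat scalerA mulVf ?scale1r ?card_group_neq0.
move=> y V'y; rewrite (tensorU_flag_unip _ v h'_gt0 V'y).
have Py := subsetP (flag_unip_sub_parab F n _) y V'y.
have Vu := flag_unip_conjV c kN (Levi_part_in Py) (Levi_part_flag_unip h'_gt0 V'y).
rewrite -[RHS](avg_gact _ Vu); congr (avg IM _ _).
by rewrite gact_tensorU mulgKV.
Qed.

Definition coset_coef k' c' : 'Hom(IM, Resf M) :=
  (ind_coef (Inf (Resf M)) \o gact IM (coset_rep n k' c')^-1)%VF.

Lemma coset_coef_neq h k k' c c' v : (k < N)%N -> (k' < N)%N ->
  ~ (k = k' /\ forall i, (h <= i < k)%N -> c i = c' i) ->
  coset_coef k' c' (avg IM (flag_unip F n h) (tensorU (dl (coset_rep n k c)) v)) = 0.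
Proof.
move=> kN k'N neq; rewrite avgE linearZ linear_sum /= big1 ?scaler0 // => u Vu.
rewrite comp_lfunE !gact_tensorU [LHS]ind_coef_tensor.
by rewrite mulgA ifN //; apply/negP=> /(coset_rep_inj kN k'N Vu).
Qed.

(** The coefficient at $g$ is $|S|/|V_h|$ times [v], where $S=V_h\cap gPg^{-1}$: for $u\in S$ the
    element $g^{-1}ug$ lies in $V_{h'}$, and its Levi part fixes [v]. The scalar is nonzero because
    $1\in S$ and the characteristic is $0$. *)
Lemma coset_coef_eq h k c v : (k < N)%N ->
  v \in limg (avg M (flag_unip F n (next_height h k))) ->
  coset_coef k c (avg IM (flag_unip F n h) (tensorU (dl (coset_rep n k c)) v)) = 0 ->
  v = 0.
Proof.
move=> kN /memv_imgP[v0 _ Dv].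
have h'_gt0 : (0 < next_height h k)%N by rewrite /next_height; lia.
have Uv : eU M v = v.
  by rewrite Dv [LHS]avg_subr // -flag_unip1 flag_unipS.
set S := [set u in flag_unip F n h |
  ((coset_rep n k c)^-1 * (u * coset_rep n k c))%g \in parab F n].
rewrite avgE linearZ linear_sum /=.
rewrite (eq_bigr (fun u => if u \in S then res_proj v else 0)) => [|u Vu].
  rewrite -big_mkcondr /= (eq_bigl (mem S)) => [|u]; last first.
    by apply/andP/idP => [[]|Su] //; split=> //; case/setIdP: Su.
  rewrite sumr_const -scaler_nat scalerA => /eqP.
  rewrite scaler_eq0 mulf_eq0 invr_eq0 (negPf (card_group_neq0 _ _)) /= => /orP[|].
    rewrite pnatr_eq0 cards_eq0 => /eqP S0.
    have : 1%g \in S by rewrite inE group1 mul1g mulVg group1.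
    by rewrite S0 inE.
  by move/eqP/(congr1 vsval); rewrite [LHS]val_res_proj Uv.
rewrite comp_lfunE !gact_tensorU [LHS]ind_coef_tensor inE Vu /=.
case: ifP => // Pz; set z := (_ * _)%g in Pz *.
have V'z : z \in flag_unip F n (next_height h k).
  by apply: (flag_unip_conj (c := c) kN Vu Pz); rewrite mulKVg.
have Ez : gact M (Levi_part z) v = v.
  by rewrite Dv gact_avg // Levi_part_flag_unip.
apply: val_inj; rewrite -[RHS]/(vsval (res_proj v)) -[LHS]/(vsval (res_act M _ _)).
by rewrite res_actE ?Levi_part_in // !val_res_proj Uv Ez.
Qed.

End HarishChandraStep.

(** * The basis *)

Fixpoint star_heights_from (h : nat) (s : seq nat) : seq nat :=
  if s is k :: s' then minn k h :: star_heights_from (next_height h k) s' else [::].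

Lemma star_heightsE s : star_heights s = star_heights_from 0 s.
Proof.
(* The accumulated heights influence later ones only through their running bound. *)
have foldlE : forall hs, foldl (fun hs k => rcons hs (minn k (\max_(h <- hs) h.+1))) hs s
    = hs ++ star_heights_from (\max_(h <- hs) h.+1) s.
  elim: s => [|k s IHs] hs /=; first by rewrite cats0.
  by rewrite IHs cat_rcons -cats1 big_cat big_seq1.
by rewrite /star_heights foldlE big_nil.
Qed.

(** * Counting the indices $K$ *)

Section IndexCount.
Variables (F : finFieldType) (n : nat).
Local Open Scope nat_scope.
Local Notation q := #|F|.

Definition tuple_weight h r (k : r.-tuple 'I_n) : nat :=
  \prod_(j < r) q ^ (tnth k j - nth 0 (star_heights_from h (map val k)) j).

Lemma tuple_weight_cons h r (k0 : 'I_n) (k : r.-tuple 'I_n) :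
  tuple_weight h [tuple of k0 :: k] =
  q ^ (k0 - h) * tuple_weight (next_height h k0) k.
Proof.
rewrite /tuple_weight big_ord_recl; congr (_ * _).
  by congr (_ ^ _); rewrite tnth0 /=; lia.
by apply: eq_bigr => j _; rewrite tnthS.
Qed.

Lemma big_tuple_cons r (f : r.+1.-tuple 'I_n -> nat) (P : pred 'I_n) :
  \sum_(k : r.+1.-tuple 'I_n | P (thead k)) f k =
  \sum_(k0 | P k0) \sum_(k : r.-tuple 'I_n) f [tuple of k0 :: k].
Proof.
rewrite (pair_big P xpredT (fun k0 (k : r.-tuple 'I_n) => f [tuple of k0 :: k])) /=.
rewrite (reindex (fun p : 'I_n * r.-tuple 'I_n => [tuple of p.1 :: p.2])) /=.
  by apply: eq_bigl => p; rewrite theadE andbT.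
exists (fun k : r.+1.-tuple 'I_n => (thead k, [tuple of behead k])) => [[k0 k] _|k _] /=.
  by rewrite theadE; congr (_, _); apply: val_inj.
by rewrite [RHS](tuple_eta k).
Qed.

Lemma sum_tuple_weight r h :
  \sum_(k : r.-tuple 'I_n) tuple_weight h k = indexed_count n q r h.
Proof.
elim: r h => [|r IHr] h.
  rewrite (eq_bigr (fun=> 1)) => [|k _]; last by rewrite /tuple_weight big_ord0.
  by rewrite sum_nat_const card_tuple expn0.
rewrite (big_tuple_cons _ xpredT) /=; apply: eq_bigr => k0 _.
rewrite -IHr big_distrr /=; apply: eq_bigr => k _.
exact: tuple_weight_cons.
Qed.

Lemma card_Pnr_cond r (P : pred (r.-tuple 'I_n)) :
  #|[pred K : Pnr F n r | P (tag K)]| = \sum_(k | P k) tuple_weight 0 k.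
Proof.
rewrite -sum1_card.
rewrite (eq_bigl (fun K : Pnr F n r => P (tag K) && true)) => [|K]; last first.
  by rewrite andbT.
rewrite -(@sig_big_dep _ _ addn _ _ P (fun _ => xpredT) (fun _ _ => 1)) /=.
apply: eq_bigr => k _; rewrite sum1_card card_dep_ffun foldrE big_map big_enum /=.
by apply: eq_bigr => j _; rewrite card_tuple /star_height star_heightsE.
Qed.

Lemma card_Pnr r : #|Pnr F n r| = indexed_count n q r 0.
Proof. by rewrite -sum_tuple_weight -(card_Pnr_cond xpredT). Qed.

(** A first entry $0$ has no parameter and moves the bound from $0$ to $1$. *)
Lemma card_Pnr_head0 r : 0 < n ->
  #|[pred K : Pnr F n r.+1 | val (tnth (tag K) ord0) == 0]| = indexed_count n q r 1.
Proof.
move=> n_gt0; rewrite (card_Pnr_cond (fun k : r.+1.-tuple 'I_n => val (tnth k ord0) == 0)).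
rewrite (big_tuple_cons _ (fun k0 => val k0 == 0)).
rewrite (eq_bigl (pred1 (Ordinal n_gt0))) => [|k0]; last by rewrite /= -val_eqE.
rewrite big_pred1_eq -sum_tuple_weight; apply: eq_bigr => k _.
by rewrite tuple_weight_cons mul1n.
Qed.

End IndexCount.

(** * Spanning, lower bound for the dimension, and the two bases *)

Section Basis.
Variables (C : numFieldType) (F : finFieldType) (n : nat).
Hypothesis n_gt0 : (0 < n)%N.
Local Notation N := n.-1.+1.
Local Notation GLn := {'GL_n[F]}.
Local Notation IRr r := (IR C F n r).
Local Notation V h := (flag_unip F n h).

Lemma ltn_predS k : (k < n)%N -> (k < N)%N.
Proof. by rewrite prednK. Qed.

(** $v_K$ with $\ast$-heights started at an arbitrary bound. Indices are functions on [nat], so the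
    induction avoids the dependent type [Pnr]. *)
Fixpoint star_tensor r : nat -> (nat -> nat) -> (nat -> nat -> F) -> IRr r :=
  match r return nat -> (nat -> nat) -> (nat -> nat -> F) -> IRr r with
  | 0 => fun _ _ _ => (1 : C^o)
  | r'.+1 => fun h k c =>
      tensorU (wstar_of C n (k 0%N) (minn (k 0%N) h) (c 0%N))
        (star_tensor r' (next_height h (k 0%N)) (k \o S) (c \o S))
  end.

(** Spanning is phrased through subspaces [Q] because the induction hypothesis is applied to a
    preimage of [Q] under a linear map. *)
Lemma avg_star_tensor_spanning r h (Q : {vspace IRr r}) :
  (forall k c, (forall j, (k j < n)%N) -> avg (IRr r) (V h) (star_tensor r h k c) \in Q) ->
  forall v, avg (IRr r) (V h) v \in Q.
Proof.
elim: r h Q => [|r IHr] h Q Qk v.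
  have -> : v = (v : C) *: (1 : C^o) by rewrite [RHS]mulr1.
  rewrite linearZ memvZ //.
  exact: (Qk (fun=> 0%N) (fun _ _ => 0)).
suff : v \in (avg (IRr r.+1) (V h) @^-1: Q)%VS by rewrite memv_preim.
apply: tensorU_spanning => k c w kN; rewrite -memv_preim avg_tensorU_avg //.
pose f : 'Hom(IRr r, IRr r.+1) :=
  (avg (IRr r.+1) (V h) \o linfun (tensorU (galg_of C (coset_rep n k c))))%VF.
have fE x : f x = avg (IRr r.+1) (V h) (tensorU (galg_of C (coset_rep n k c)) x).
  by rewrite comp_lfunE lfunE.
rewrite -fE memv_preim; apply: IHr => ks cs ksn; rewrite -memv_preim fE.
rewrite -avg_tensorU_avg // -avg_wstar //.
apply: (Qk (fun j => if j is j'.+1 then ks j' else k)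
           (fun j => if j is j'.+1 then cs j' else c)) => -[|j] //.
by rewrite -(prednK n_gt0).
Qed.

Lemma leq_dim_limg_avg r h :
  (indexed_count n #|F| r h <= \dim (limg (avg (IRr r) (V h))))%N.
Proof.
elim: r h => [|r IHr] h.
  rewrite lt0n dimv_eq0; apply/eqP=> limg0.
  have : avg (IRr 0) (V h) (1 : C^o) \in limg (avg (IRr 0) (V h)).
    by rewrite memv_img ?memvf.
  rewrite limg0 memv0 avg_fixed => [|u _]; last by rewrite id_lfunE.
  by rewrite oner_eq0.
(* [J] indexes the $V_h$-orbits of lines; for $k<h$ the tuple is empty, giving one orbit. The values
   of [c j] below [h] are arbitrary, as they do not affect the orbit. *)
pose J : finType := {k : 'I_n & (k - h).-tuple F}.
pose c (j : J) i := nth 0 (tagged j) (i - h).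
pose h' (j : J) := next_height h (tag j).
pose f (j : J) : 'Hom(IRr r, IRr r.+1) :=
  (avg (IRr r.+1) (V h) \o linfun (tensorU (galg_of C (coset_rep n (tag j) (c j)))))%VF.
have fE j x : f j x = avg (IRr r.+1) (V h) (tensorU (galg_of C (coset_rep n (tag j) (c j))) x).
  by rewrite comp_lfunE lfunE.
pose U j := (f j @: limg (avg (IRr r) (V (h' j))))%VS.
have jN (j : J) : (tag j < N)%N by apply: ltn_predS.
have f_inj j v : v \in limg (avg (IRr r) (V (h' j))) ->
    coset_coef (IRr r) (tag j) (c j) (f j v) = 0 -> v = 0.
  by rewrite fE; apply: coset_coef_eq.
have f_neq (i j : J) v : i != j -> coset_coef (IRr r) (tag i) (c i) (f j v) = 0.
  move=> ij; rewrite fE; apply: coset_coef_neq => // -[kk cc].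
  case/eqP: ij; case: i j kk cc => [k a] [k' a'] /=.
  move=> /val_inj kk; case: _ / kk a => a aa.
  congr (Tagged _ _); apply: eq_from_tnth => i; rewrite !(tnth_nth 0).
  have := aa (h + i)%N; rewrite /c /= addKn => -> //.
  by have := ltn_ord i; lia.
have dU j : \dim (U j) = \dim (limg (avg (IRr r) (V (h' j)))).
  apply/limg_dim_eq/eqP; rewrite -subv0; apply/subvP=> v.
  rewrite memv_cap memv_ker memv0 => /andP[Vv /eqP fv0].
  by apply/eqP/(f_inj _ _ Vv); rewrite fv0 linear0.
have dxU : directv (\sum_j U j)%VS.
  apply/directv_sum_independent=> us Uu us0 i _.
  have /memv_imgP[v Vv Dv] := Uu i isT.
  suff v0 : v = 0 by rewrite Dv v0 linear0.
  apply: f_inj Vv _; rewrite -Dv.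
  have := congr1 (coset_coef (IRr r) (tag i) (c i)) us0.
  rewrite linear0 linear_sum (bigD1 i) //= big1 ?addr0 // => j ji.
  have /memv_imgP[w _ ->] := Uu j isT.
  by rewrite f_neq // eq_sym.
have sU : (\sum_j U j <= limg (avg (IRr r.+1) (V h)))%VS.
  apply/subv_sumP=> j _; apply/subvP=> _ /memv_imgP[v _ ->].
  by rewrite fE memv_img ?memvf.
apply: leq_trans (dimvS sU); rewrite (directvP dxU) /=.
rewrite (eq_bigr (fun j : J => \dim (limg (avg (IRr r) (V (next_height h (tag j))))))) //.
rewrite -(@sig_big_dep _ _ addn _ _ xpredT (fun _ => xpredT)
  (fun (k : 'I_n) (_ : (k - h).-tuple F) => \dim (limg (avg (IRr r) (V (next_height h k)))))) /=.
by apply: leq_sum => k _; rewrite sum_nat_const card_tuple leq_mul2l IHr orbT.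
Qed.

Lemma iter_tensorU_star r h (k : nat -> nat) (c : nat -> nat -> F) (hs : nat -> nat) :
  (forall j, (j < r)%N -> hs j = nth 0%N (star_heights_from h (mkseq k r)) j) ->
  iter_tensorU [tuple wstar_of C n (k j) (hs j) (c j) | j < r] = star_tensor r h k c.
Proof.
elim: r h k c hs => [|r IHr] h k c hs hsE //=.
have mkS : mkseq k r.+1 = k 0%N :: mkseq (k \o S) r.
  by rewrite /mkseq /= -[1%N]add1n iotaDl -map_comp.
congr (tensorU _ _).
  by rewrite /thead tnth_mktuple hsE // mkS.
rewrite -(IHr _ _ _ (hs \o S)) => [|j jr]; last by rewrite /= hsE // mkS.
congr iter_tensorU; apply: eq_from_tnth => j.
by rewrite tnth_behead !tnth_mktuple inordK ?ltnS.
Qed.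

(** Spanning by the [star_tensor]s thereby becomes spanning by the [vK]. *)
Lemma vK_star_tensor r (k : nat -> nat) (c : nat -> nat -> F) : (forall j, (k j < n)%N) ->
  exists2 K : Pnr F n r, (forall j, val (tnth (tag K) j) = k j) &
    vK C K = star_tensor r 0 k c.
Proof.
move=> kn; pose kt : r.-tuple 'I_n := [tuple Ordinal (kn j) | j < r].
pose a : {dffun forall j : 'I_r, (tnth kt j - star_height kt j).-tuple F} :=
  [ffun j => [tuple c j (star_height kt j + i)%N | i < tnth kt j - star_height kt j]].
exists (Tagged (fun kt : r.-tuple 'I_n =>
    {dffun forall j : 'I_r, (tnth kt j - star_height kt j).-tuple F}) a) => [j|].
  by rewrite tnth_mktuple.
rewrite -(@iter_tensorU_star r 0 k c (fun j => nth 0%N (star_heights_from 0 (mkseq k r)) j)) //.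
congr iter_tensorU; apply: eq_from_tnth => j; rewrite !tnth_mktuple /= ffunE.
transitivity (wstar_of C n (tnth kt j) (star_height kt j) (c j)) => //.
have -> : star_height kt j = nth 0%N (star_heights_from 0 (mkseq k r)) j.
  rewrite /star_height star_heightsE; congr (nth _ (star_heights_from _ _) _).
  by rewrite -map_comp (eq_map (g := k \o val)) // map_comp val_enum_ord.
by rewrite !tnth_mktuple.
Qed.

Lemma galg_of_wstar0 c : wstar_of C n 0 0 c = galg_of C (1 : GLn)%g.
Proof.
rewrite /wstar_of /wstar galg_mul_sumr expn0 invr1 scale1r.
rewrite (eq_bigr (fun=> galg_of C (1 : GLn)%g)) => [|b _].
  by rewrite sumr_const card_tuple.
by rewrite galg_mul_of /sgen_prod !big_ord0 mulg1.
Qed.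

Lemma size_filter_enum (T : finType) (P : pred T) (A : Type) (f : T -> A) :
  size [seq f x | x <- enum T & P x] = #|P|.
Proof. by rewrite size_map cardE enumT. Qed.

Lemma IR_basis r : basis_of {: IRr r} [seq vK C K | K <- enum (Pnr F n r)].
Proof.
rewrite basisEdim; apply/andP; split.
  apply/subvP=> v _; rewrite -[v]avg_trivial -flag_unip0.
  apply: avg_star_tensor_spanning => k c kn.
  rewrite flag_unip0 avg_trivial; have [K _ <-] := vK_star_tensor r c kn.
  by apply/memv_span/map_f; rewrite mem_enum.
rewrite size_map -cardE card_Pnr; apply: leq_trans (leq_dim_limg_avg r 0) _.
exact/dimvS/subvf.
Qed.

Lemma dim_IR r : \dim {: IRr r} = indexed_count n #|F| r 0.
Proof. by rewrite (size_basis (IR_basis r)) card_Pnr. Qed.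

Lemma eU_avg (M : gmodule C [group of [set: GLn]]) : eU M = avg M (V 1).
Proof. by rewrite flag_unip1. Qed.

Lemma linfun_tensorE (gT : finGroupType) (H : {group gT}) (W : gmodule C H)
  (x : galg C gT) (w : W) : linfun (tensor x) w = tensor x w.
Proof. by rewrite lfunE. Qed.

Lemma IRhalf_embE r (w : IRhalf C F n r) :
  IRhalf_emb C F n r w = tensor (W := Inf (IRhalf C F n r)) (galg_of C 1%g) w.
Proof. exact: (linfun_tensorE (W := Inf (IRhalf C F n r)) (galg_of C 1%g) w). Qed.

Lemma dim_limg_IRhalf_emb r : \dim (limg (IRhalf_emb C F n r)) = \dim {: IRhalf C F n r}.
Proof.
apply/limg_dim_eq/eqP; rewrite capfv -subv0; apply/subvP=> w.
rewrite memv_ker IRhalf_embE memv0 => /eqP w0.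
apply/eqP/(@tensor1_inj _ _ _ (Inf (IRhalf C F n r))).
by rewrite [RHS]linear0.
Qed.

Lemma dim_IRhalf_ge r : (indexed_count n #|F| r 1 <= \dim {: IRhalf C F n r})%N.
Proof. by rewrite dimvf; apply: leq_trans (leq_dim_limg_avg r 1) _; rewrite -eU_avg. Qed.

Lemma IRhalf_basis r : basis_of (limg (IRhalf_emb C F n r))
  [seq vK C K | K <- enum (Pnr F n r.+1) & val (tnth (tag K) ord0) == 0%N].
Proof.
rewrite basisEdim; apply/andP; split; last first.
  rewrite size_filter_enum dim_limg_IRhalf_emb.
  by rewrite (card_Pnr_head0 F r n_gt0) dim_IRhalf_ge.
set X := [seq _ | _ <- _ & _].
pose f : 'Hom(IRr r, IRr r.+1) := linfun (tensorU (galg_of C 1%g)).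
apply/subvP=> _ /memv_imgP[w _ ->].
have -> : IRhalf_emb C F n r w = f (vsval w).
  by rewrite IRhalf_embE -{1}[w]res_projK [RHS]lfunE.
have /memv_imgP[v _ ->] := subvsP w.
rewrite eU_avg memv_preim; apply: avg_star_tensor_spanning => k c kn.
rewrite -memv_preim.
(* A head entry $0$ is put in front: its word is $1$ and it starts the remaining heights at $1$, so
   the result is $1\otimes_U$ the given [star_tensor], with $e_U$ absorbed by the tensor sign. *)
pose k0 j := if j is j'.+1 then k j' else 0%N.
pose c0 j : nat -> F := if j is j'.+1 then c j' else fun=> 0.
have k0n j : (k0 j < n)%N by case: j.
have [K Kk vKE] := vK_star_tensor r.+1 c0 k0n.
suff -> : f (avg (IRr r) (V 1) (star_tensor r 1 k c)) = vK C K.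
  by apply/memv_span/map_f; rewrite mem_filter mem_enum Kk.
by rewrite vKE lfunE /= galg_of_wstar0 -eU_avg tensorU_eU.
Qed.

Lemma dim_IRhalf r : \dim {: IRhalf C F n r} = indexed_count n #|F| r 1.
Proof.
rewrite -dim_limg_IRhalf_emb.
rewrite (size_basis (IRhalf_basis r : basis_of _ (in_tuple _))).
by rewrite size_filter_enum card_Pnr_head0.
Qed.

End Basis.

Theorem theorem3p2 (R : realType) (F : finFieldType) (n r : nat)
    (n_gt0 : (0 < n)%N) :
  (basis_of {: IR R[i] F n r} [seq vK R[i] K | K <- enum (Pnr F n r)] /\
   (\dim {: IR R[i] F n r})%:R = dnr n r #|F|)
  /\
  (basis_of (limg (IRhalf_emb R[i] F n r))
     [seq vK R[i] K | K <- enum (Pnr F n r.+1) & val (tnth (tag K) ord0) == 0%N] /\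
   (\dim {: IRhalf R[i] F n r})%:R = dnr n r.+1 #|F| / qnum #|F| n).
Proof.
have q_gt1 : (1 < #|F|)%N := card_finNzRing_gt1 F.
split; split.
- exact: (IR_basis R[i] F n_gt0 r).
- by rewrite dnrE // (dim_IR R[i] F n_gt0 r).
- exact: (IRhalf_basis R[i] F n_gt0 r).
by rewrite dnrS_div // (dim_IRhalf R[i] F n_gt0 r).
Qed.
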